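(* Let $M$ be a locally $k$-standard $T$-manifold with $\dim M=2n+k$ such that $M/T^{n+k}$ is a simple polytope $P$, and let $\lambda:\mathcal{F}(P)\to\mathbb{Z}^{n+k}$ be the function assigning to each facet $F_i$ the primitive vector determining the isotropy circle subgroup $T_i$ of $M_i=\mathfrak{q}^{-1}(F_i)$, where $\mathfrak{q}:M\to P$ is the orbit map. Then $M$ is equivariantly homeomorphic to $M(P,\lambda)$.
   Context: The $k$-standard action of $T^{n+k}$ on $\mathbb{C}^n\times T^k\subset\mathbb{C}^{n+k}$ is coordinatewise multiplication. A locally $k$-standard $T$-manifold is a smooth $(2n+k)$-dimensional manifold $M$ with an effective $T^{n+k}$-action such that each point $p$ has a $T^{n+k}$-invariant neighborhood which, for some $\theta_p\in\operatorname{Aut}(T^{n+k})$, is $\theta_p$-equivariantly diffeomorphic to a $T^{n+k}$-invariant subset of $\mathbb{C}^n\times T^k$. Its orbit space is an $n$-dimensional manifold with corners; ''$M/T^{n+k}$ is a simple polytope $P$'' is understood as manifolds with corners. $\mathcal{F}(P)=\{F_1,\dots,F_m\}$ is the set of facets of $P$. The isotropy subgroup of the $T^{n+k}$-invariant submanifold $M_i=\mathfrak{q}^{-1}(F_i)$ is a circle subgroup $T_i\subset T^{n+k}$, determined by a primitive vector $\lambda_i=\lambda(F_i)\in\mathbb{Z}^{n+k}\cong\operatorname{Hom}(S^1,T^{n+k})$ (unique up to sign). $M(P,\lambda)=(T^{n+k}\times P)/_\sim$, where $(t,p)\sim(s,q)$ iff $p=q$ and $t^{-1}s\in T_p$; here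 $T_p$ is the subgroup of $T^{n+k}$ determined by $\{\lambda_{j_1},\dots,\lambda_{j_\ell}\}$ when $p$ is in the relative interior of the face $F_{j_1}\cap\dots\cap F_{j_\ell}$, and is trivial when $p$ is in the interior of $P$. $T^{n+k}$ acts on $M(P,\lambda)$ by multiplication on the first factor. *)

(* Defs.v *)
From HB Require Import structures.
From mathcomp Require Import all_boot all_order all_algebra.
From mathcomp Require Import complex.
From mathcomp Require Import all_classical all_reals all_analysis.

Set Implicit Arguments.
Unset Strict Implicit.
Unset Printing Implicit Defensive.

Import Order.TTheory GRing.Theory Num.Theory.
Import numFieldNormedType.Exports.

Local Open Scope classical_set_scope.
Local Open Scope ring_scope.
Local Open Scope complex_scope.
Local Open Scope quotient_scope.

Fixpoint iter_derive (R : realType) (d e : nat) (s : seq 'rV[R]_d)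
    (f : 'rV[R]_d -> 'rV[R]_e) : 'rV[R]_d -> 'rV[R]_e :=
  if s is v :: s' then fun x => 'D_v (iter_derive s' f) x else f.

Definition Cinfty (R : realType) (d e : nat) (U : set 'rV[R]_d)
    (f : 'rV[R]_d -> 'rV[R]_e) : Prop :=
  forall (s : seq 'rV[R]_d) (x : 'rV[R]_d), U x ->
    {for x, continuous (iter_derive s f)} /\
    forall v, derivable (iter_derive s f) x v.

Record chart (R : realType) (X : Type) (d : nat) := Chart {
  chart_dom : set X;
  chart_map :> X -> 'rV[R]_d }.

(* Smoothness of f on D, read in charts.  When an image of a chart is not open
   in R^d (the torus in R^2N, an orthant, a polytope), a map on it is smooth if
   it extends, near each point, to a C^oo map on an open subset of R^d. *)
Definition smooth_map (R : realType) (X Y : topologicalType) (d e : nat)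
    (A : set (chart R X d)) (B : set (chart R Y e)) (D : set X) (f : X -> Y) :
    Prop :=
  {within D, continuous f} /\
  forall (a : chart R X d) (b : chart R Y e) (x : X),
    A a -> B b -> D x -> chart_dom a x -> chart_dom b (f x) ->
    exists (U : set 'rV[R]_d) (g : 'rV[R]_d -> 'rV[R]_e),
      [/\ open U, U (a x), Cinfty U g &
          forall y, D y -> chart_dom a y -> chart_dom b (f y) -> U (a y) ->
            b (f y) = g (a y)].

Definition diffeomorphism (R : realType) (X Y : topologicalType) (d e : nat)
    (A : set (chart R X d)) (B : set (chart R Y e)) (U : set X) (V : set Y)
    (f : X -> Y) : Prop :=
  [/\ set_bij U V f, smooth_map A B U f &
      exists g : Y -> X, {in U, cancel f g} /\ smooth_map B A V g].

Definition smooth_manifold (R : realType) (M : topologicalType) (d : nat)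
    (A : set (chart R M d)) : Prop :=
  [/\ hausdorff_space M, @second_countable M,
      forall x, exists2 c, A c & chart_dom c x,
      forall c, A c ->
        [/\ open (chart_dom c), set_inj (chart_dom c) c,
            {within chart_dom c, continuous c} &
            forall W, open W -> W `<=` chart_dom c -> open (c @` W)] &
      (* the changes of charts are smooth *)
      smooth_map A A setT idfun].

Definition prod_chart (R : realType) (X Y : Type) (d e : nat)
    (a : chart R X d) (b : chart R Y e) : chart R (X * Y) (d + e) :=
  Chart (chart_dom a `*` chart_dom b) (fun p => row_mx (a p.1) (b p.2)).

Definition prod_atlas (R : realType) (X Y : Type) (d e : nat)
    (A : set (chart R X d)) (B : set (chart R Y e)) :
    set (chart R (X * Y) (d + e)) :=
  [set prod_chart a b | a in A & b in B].

Definition euclidean_atlas (R : realType) (d : nat) :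
    set (chart R 'rV[R]_d d) := [set Chart setT idfun].

Definition cvec (R : realType) (N : nat) : Type := 'rV[R[i]]_N.

Definition reim (R : realType) (N : nat) (z : 'rV[R[i]]_N) : 'rV[R]_(N + N) :=
  row_mx (map_mx (@complex.Re R) z) (map_mx (@complex.Im R) z).

(* C^N carries the topology and the smooth structure of R^2N *)
HB.instance Definition _ (R : realType) (N : nat) :=
  Topological.copy (cvec R N) (initial_topology (@reim R N)).

Definition cvec_atlas (R : realType) (N : nat) :
    set (chart R (cvec R N) (N + N)) := [set Chart setT (@reim R N)].

Definition torus_set (R : realType) (N : nat) : set (cvec R N) :=
  [set z | forall i, `|z 0 i| = 1].

Definition torus (R : realType) (N : nat) : Type := set_type (@torus_set R N).

Definition tval (R : realType) (N : nat) (t : torus R N) : 'rV[R[i]]_N :=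
  set_val t.

HB.instance Definition _ (R : realType) (N : nat) :=
  Topological.on (torus R N).

Section TorusGroup.
Variables (R : realType) (N : nat).
Implicit Types s t u : torus R N.

Lemma tvalP t i : `|tval t 0 i| = 1.
Proof. exact: (set_mem (valP t)). Qed.

Lemma tval_inj : injective (@tval R N).
Proof. exact: val_inj. Qed.

Fact tone_subproof : (const_mx 1 : cvec R N) \in @torus_set R N.
Proof. by apply/mem_set => i; rewrite mxE normr1. Qed.

Fact tinv_subproof t :
  (map_mx (@GRing.inv _) (tval t) : cvec R N) \in @torus_set R N.
Proof. by apply/mem_set => i; rewrite mxE normfV tvalP invr1. Qed.

Fact tmul_subproof s t :
  (\row_i (tval s 0 i * tval t 0 i) : cvec R N) \in @torus_set R N.
Proof. by apply/mem_set => i; rewrite mxE normrM !tvalP mulr1. Qed.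

Definition tone : torus R N :=
  exist (fun z => z \in @torus_set R N) _ tone_subproof.
Definition tinv t : torus R N :=
  exist (fun z => z \in @torus_set R N) _ (tinv_subproof t).
Definition tmul s t : torus R N :=
  exist (fun z => z \in @torus_set R N) _ (tmul_subproof s t).

Fact tmulA : associative tmul.
Proof. by move=> s t u; apply/tval_inj/rowP => i; rewrite !mxE mulrA. Qed.

Fact tmul1 : left_id tone tmul.
Proof. by move=> t; apply/tval_inj/rowP => i; rewrite !mxE mul1r. Qed.

Fact tmulr1 : right_id tone tmul.
Proof. by move=> t; apply/tval_inj/rowP => i; rewrite !mxE mulr1. Qed.

Fact tmulV : left_inverse tone tinv tmul.
Proof.
move=> t; apply/tval_inj/rowP => i; rewrite !mxE mulVf//.
by rewrite -normr_eq0 tvalP oner_eq0.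
Qed.

Fact tmulrV : right_inverse tone tinv tmul.
Proof.
move=> t; apply/tval_inj/rowP => i; rewrite !mxE mulfV//.
by rewrite -normr_eq0 tvalP oner_eq0.
Qed.

HB.instance Definition _ := isGroup.Build (torus R N)
  tmulA tmul1 tmulr1 tmulV tmulrV.

End TorusGroup.

Definition torus_atlas (R : realType) (N : nat) :
    set (chart R (torus R N) (N + N)) :=
  [set Chart setT (fun t => reim (tval t))].

Definition torus_automorphism (R : realType) (N : nat)
    (theta : torus R N -> torus R N) : Prop :=
  [/\ {morph theta : s t / (s * t)%g}, continuous theta &
      exists theta', [/\ cancel theta theta', cancel theta' theta &
                         continuous theta']].

(* C^n x T^k, inside C^(n+k) *)
Definition kstandard_space (R : realType) (n k : nat) : set (cvec R (n + k)) :=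
  [set z | forall j : 'I_k, `|z 0 (rshift n j)| = 1].

Definition kstandard_act (R : realType) (N : nat) (t : torus R N)
    (z : cvec R N) : cvec R N := \row_i (tval t 0 i * z 0 i).

Record torus_action (R : realType) (N : nat) (M : Type) := TorusAction {
  tact :> torus R N -> M -> M;
  tact1 : forall x, tact 1%g x = x;
  tactM : forall s t x, tact (s * t)%g x = tact s (tact t x) }.

(* A theta-equivariant diffeomorphism from an invariant open U onto its image,
   which is invariant (theta is onto) and open in C^n x T^k. *)
Definition kstandard_chart (R : realType) (n k : nat) (M : topologicalType)
    (A : set (chart R M (n.*2 + k))) (act : torus_action R (n + k) M)
    (U : set M) (theta : torus R (n + k) -> torus R (n + k))
    (phi : M -> cvec R (n + k)) : Prop :=
  [/\ open U /\ (forall t x, U x -> U (act t x)),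
      torus_automorphism theta,
      (exists2 W, open W & phi @` U = W `&` @kstandard_space R n k),
      diffeomorphism A (@cvec_atlas R (n + k)) U (phi @` U) phi &
      forall t x, U x -> phi (act t x) = kstandard_act (theta t) (phi x)].

Definition locally_kstandard (R : realType) (n k : nat) (M : topologicalType)
    (A : set (chart R M (n.*2 + k))) (act : torus_action R (n + k) M) : Prop :=
  [/\ smooth_manifold A,
      smooth_map (prod_atlas (@torus_atlas R (n + k)) A) A setT
        (fun p => act p.1 p.2),
      forall t, (forall x, act t x = x) -> t = 1%g &
      forall p, exists U theta phi,
        U p /\ kstandard_chart A act U theta phi].

Section OrbitSpace.
Variables (R : realType) (N : nat) (M : topologicalType).
Variable act : torus_action R N M.

Definition same_orbit (x y : M) : bool := `[< exists t, act t x = y >].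

Fact same_orbit_refl : reflexive same_orbit.
Proof. by move=> x; apply/asboolP; exists 1%g; rewrite tact1. Qed.

Fact same_orbit_sym : symmetric same_orbit.
Proof.
move=> x y; apply/idP/idP => /asboolP[t <-]; apply/asboolP; exists (t^-1)%g;
  by rewrite -tactM mulVg tact1.
Qed.

Fact same_orbit_trans : transitive same_orbit.
Proof.
move=> y x z /asboolP[s <-] /asboolP[t <-]; apply/asboolP.
by exists (t * s)%g; rewrite tactM.
Qed.

Definition orbit_rel :=
  EquivRel same_orbit same_orbit_refl same_orbit_sym same_orbit_trans.

Definition orbit_space : Type := {eq_quot orbit_rel}.

HB.instance Definition _ := Topological.copy orbit_space
  (quotient_topology {eq_quot orbit_rel}).
HB.instance Definition _ := Quotient.on orbit_space.

Definition orbit_map (x : M) : orbit_space := \pi_orbit_space x.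

End OrbitSpace.

(* The orbit map C^n x T^k -> R_>=0^n of the k-standard action; with the
   squares, the smooth functions on the orbit space are those whose pullbacks
   to M are smooth. *)
Definition sqmoduli (R : realType) (n k : nat) (z : cvec R (n + k)) :
    'rV[R]_n :=
  \row_i (complex.Re (z 0 (lshift k i)) ^+ 2 +
          complex.Im (z 0 (lshift k i)) ^+ 2).

(* M/T^(n+k) as a manifold with corners: the charts onto relatively open subsets
   of R_>=0^n induced by the locally k-standard charts of M *)
Definition orbit_atlas (R : realType) (n k : nat) (M : topologicalType)
    (A : set (chart R M (n.*2 + k))) (act : torus_action R (n + k) M) :
    set (chart R (orbit_space act) n) :=
  [set c | exists U theta phi,
    [/\ kstandard_chart A act U theta phi,
        chart_dom c = orbit_map act @` U &
        forall x, U x -> c (orbit_map act x) = sqmoduli (phi x)]].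

Arguments orbit_atlas {R n k M} A act.

Definition polytope (R : realType) (n : nat) (P : set 'rV[R]_n) : Prop :=
  exists (l : nat) (v : 'I_l -> 'rV[R]_n),
    P = [set x | exists w : 'I_l -> R,
      [/\ forall i, 0 <= w i, \sum_i w i = 1 & x = \sum_i w i *: v i]].

(* The affine hull of A is a translate of the row space of an r x n matrix of
   rank r. *)
Definition affine_dim (R : realType) (n : nat) (A : set 'rV[R]_n) (r : nat) :
    Prop :=
  exists (x0 : 'rV[R]_n) (B : 'M[R]_(r, n)),
    [/\ A x0, row_free B, forall i, A (x0 + row i B) &
        forall x, A x -> (x - x0 <= B)%MS].

Definition face (R : realType) (n : nat) (P G : set 'rV[R]_n) : Prop :=
  exists (c : 'cV[R]_n) (b : R),
    (forall x, P x -> (x *m c) 0 0 <= b) /\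
    G = [set x | P x /\ (x *m c) 0 0 = b].

(* codimension one; a point (n = 0) has no facet *)
Definition facet (R : realType) (n : nat) (P G : set 'rV[R]_n) : Prop :=
  face P G /\ exists r, r.+1 = n /\ affine_dim G r.

Definition simple_polytope (R : realType) (n : nat) (P : set 'rV[R]_n) : Prop :=
  [/\ polytope P, affine_dim P n &
      forall v, face P [set v] -> ([set G | facet P G /\ G v] #= `I_n)%card].

Definition primitive (N : nat) (l : 'rV[int]_N) : Prop :=
  forall d : int, (forall i, (d %| l ord0 i)%Z) -> `|d| = 1.

Definition circle_subgroup (R : realType) (N : nat) (l : 'rV[int]_N) :
    set (torus R N) :=
  [set t | exists2 z : R[i], `|z| = 1 & forall i, tval t 0 i = z ^ l 0 i].

Section CharacteristicSpace.
Variables (R : realType) (n N m : nat).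
Variables (P : set 'rV[R]_n) (F : 'I_m -> set 'rV[R]_n).
Variable lam : 'I_m -> 'rV[int]_N.

(* T_p is generated by the circles of the facets containing p: the smallest
   face containing p is the intersection of these facets, and p lies in its
   relative interior. *)
Definition face_subgroup (p : 'rV[R]_n) : set (torus R N) :=
  [set t | exists z : 'I_m -> R[i], (forall j, `|z j| = 1) /\
    forall i, tval t 0 i = \prod_(j | `[< F j p >]) z j ^ lam j 0 i].

Definition char_eq (x y : torus R N * P) : bool :=
  `[< x.2 = y.2 /\ face_subgroup (set_val x.2) (x.1^-1 * y.1)%g >].

Fact face_subgroup1 p : face_subgroup p 1%g.
Proof.
exists (fun=> 1); split=> [j|i]; first by rewrite normr1.
by rewrite big1 ?mxE// => j _; rewrite exp1rz.
Qed.

Fact face_subgroupM p s t :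
  face_subgroup p s -> face_subgroup p t -> face_subgroup p (s * t)%g.
Proof.
move=> [z [z1 zE]] [w [w1 wE]]; exists (fun j => z j * w j).
split=> [j|i]; first by rewrite normrM z1 w1 mulr1.
rewrite mxE zE wE -big_split/=; apply: eq_bigr => j _.
have nz u : `|u : R[i]| = 1 -> u \is a GRing.unit.
  by move=> u1; rewrite unitfE -normr_eq0 u1 oner_eq0.
by rewrite exprzMl ?nz.
Qed.

Fact face_subgroupV p t : face_subgroup p t -> face_subgroup p (t^-1)%g.
Proof.
move=> [z [z1 zE]]; exists (fun j => (z j)^-1).
split=> [j|i]; first by rewrite normfV z1 invr1.
by rewrite mxE zE -prodfV; apply: eq_bigr => j _; rewrite expfV.
Qed.

Fact char_eq_refl : reflexive char_eq.
Proof.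
by move=> x; apply/asboolP; rewrite mulVg; split=> //; exact: face_subgroup1.
Qed.

Fact char_eq_sym : symmetric char_eq.
Proof.
suff H x y : char_eq x y -> char_eq y x by move=> x y; apply/idP/idP => /H.
move=> /asboolP[e h]; apply/asboolP; split; first by [].
by rewrite -e; have := face_subgroupV h; rewrite invgM invgK.
Qed.

Fact char_eq_trans : transitive char_eq.
Proof.
move=> y x z /asboolP[e h] /asboolP[e' h']; apply/asboolP.
split; first by rewrite e.
rewrite -e in h'; have := face_subgroupM h h'.
by rewrite mulgA -(mulgA x.1^-1)%g mulgV mulg1.
Qed.

Definition char_rel := EquivRel char_eq char_eq_refl char_eq_sym char_eq_trans.

Definition char_space : Type := {eq_quot char_rel}.

HB.instance Definition _ := Topological.copy char_space
  (quotient_topology {eq_quot char_rel}).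
HB.instance Definition _ := Quotient.on char_space.

Definition char_class (t : torus R N) (p : P) : char_space :=
  \pi_char_space (t, p).

Definition char_act (t : torus R N) (x : char_space) : char_space :=
  char_class (t * (repr x).1)%g (repr x).2.

Lemma char_actE t s p : char_act t (char_class s p) = char_class (t * s)%g p.
Proof.
rewrite /char_act /char_class; case: piP => -[s' p'] /= /eqmodP/asboolP/=[e h].
apply/esym/eqmodP/asboolP => /=; split=> //.
by rewrite invgM -mulgA mulKg.
Qed.

End CharacteristicSpace.

Definition homeomorphism (X Y : topologicalType) (f : X -> Y) : Prop :=
  continuous f /\
  exists g : Y -> X, [/\ cancel f g, cancel g f & continuous g].

(* Main.v *)
(* It suffices to find a continuous section s of the orbit map q : M -> P and to
   show that the isotropy group at x is the subgroup T_(q x) generated by the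
   circles of the facets containing q x: then (t, p) |-> t s(p) is a continuous
   surjection from a compact space onto a Hausdorff space, whose fibres are the
   classes of the relation defining M(P, lambda).

   Isotropy. If the i-th coordinate of x vanishes in a locally standard chart,
   the derivative at q x of the i-th coordinate of the orbit chart is a covector
   supporting P at q x. The derivative of the orbit chart is invertible and its
   inverse maps the nonnegative orthant into the tangent cone of P, so every
   covector vanishing on the same vertices is proportional to this one, which
   therefore supports P along a facet. At a nearby point where only
   that coordinate vanishes, the circle of this facet lies in the i-th coordinate
   circle, hence is equal to it, a nontrivial connected subgroup of a circle
   being the whole circle.

   Section. Contract P to a point c lying on no facet by x |-> c + t (x - c).
   Except at t = 1 the images lie on no facet, so a lift of the contraction can
   be continued over small steps in t within the charts: change the moduli of
   the coordinates and keep their arguments, which is continuous even where a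
   coordinate becomes 0. No smoothness of the change of charts is needed here. *)
Require Import Defs.
From HB Require Import structures.
From mathcomp Require Import all_boot all_order all_algebra.
From mathcomp Require Import complex.
From mathcomp Require Import all_classical all_reals all_analysis.
From mathcomp Require Import ring lra.

Set Implicit Arguments.
Unset Strict Implicit.
Unset Printing Implicit Defensive.

Import Order.TTheory GRing.Theory Num.Theory.
Import numFieldNormedType.Exports.

Local Open Scope classical_set_scope.
Local Open Scope ring_scope.
Local Open Scope complex_scope.
Local Open Scope quotient_scope.

(** * Differentials *)

(** The mean value theorem on [[0, b]] or [[b, 0]] according to the sign of [b]. Bounding [c] only
    in absolute value lets an increment of either sign be treated at once. *)
Lemma mean_value_abs (R : realType) (f df : R -> R) (r b : R) :
  `|b| < r -> (forall s : R, `|s| < r -> is_derive s 1 f (df s)) ->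
  exists2 c, `|c| <= `|b| & f b - f 0 = df c * b.
Proof.
move=> br fdf.
have cf s : `|s| < r -> {for s, continuous f}.
  move=> sr; apply: differentiable_continuous; apply/derivable1_diffP.
  by have [] := fdf s sr.
have [b0|b0] := leP 0 b.
  have in0b s : s \in `[0, b]%R -> `|s| <= `|b|.
    by rewrite in_itv/= => /andP[s0 sb]; rewrite !ger0_norm.
  have cw : {within `[0, b], continuous f}.
    apply: continuous_in_subspaceT => s /set_mem/= sb.
    by apply: cf; apply: le_lt_trans br; apply: in0b.
  have dw (s : R) : s \in `]0, b[%R -> is_derive s 1 f (df s).
    move=> sb; apply: fdf; have {}sb := subset_itv_oo_cc sb.
    exact: le_lt_trans (in0b _ sb) br.
  have [c cb fE] := MVT_segment b0 dw cw.
  by exists c; [exact: in0b|rewrite fE subr0].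
have in0b s : s \in `[b, 0]%R -> `|s| <= `|b|.
  by rewrite in_itv/= => /andP[s0 sb]; rewrite !ler0_norm ?lerN2// ltW.
have cw : {within `[b, 0], continuous f}.
  apply: continuous_in_subspaceT => s /set_mem/= sb.
  by apply: cf; apply: le_lt_trans br; apply: in0b.
have dw (s : R) : s \in `]b, 0[%R -> is_derive s 1 f (df s).
  move=> sb; apply: fdf; have {}sb := subset_itv_oo_cc sb.
  exact: le_lt_trans (in0b _ sb) br.
have [c cb fE] := MVT_segment (ltW b0) dw cw.
by exists c; [exact: in0b|rewrite -opprB fE sub0r mulrN opprK].
Qed.

Lemma is_derive_line (R : realType) (V : normedModType R) (f : V -> R) (y v : V)
  (s : R) : derivable f (y + s *: v) v ->
  is_derive s 1 (fun t => f (y + t *: v)) ('D_v f (y + s *: v)).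
Proof.
have E : (fun h : R => h^-1 *: (f (y + (h *: 1 + s) *: v) - f (y + s *: v)))
   = (fun h => h^-1 *: (f (h *: v + (y + s *: v)) - f (y + s *: v))).
  apply/funext => h; congr (_ *: (f _ - _)).
  by rewrite scalerDl addrCA; congr (_ *: v + _); rewrite /GRing.scale/= mulr1.
move=> fv; apply: DeriveDef; first by rewrite /derivable E; exact: fv.
by rewrite /derive E.
Qed.

Lemma rowv_norm_coord (R : realType) d (h : 'rV[R]_d) i : `|h 0 i| <= `|h|.
Proof.
rewrite [leRHS]/Num.norm/= mx_normrE; apply/bigmax_geP; right => /=.
by exists (0, i).
Qed.

Lemma rowv_norm_lt (R : realType) d (h : 'rV[R]_d) e :
  0 < e -> (forall i, `|h 0 i| < e) -> `|h| < e.
Proof.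
move=> e0 he; rewrite [ltLHS]/Num.norm/= mx_normrE; apply/bigmax_ltP; split => //.
by case=> i j _ /=; rewrite (ord1 i).
Qed.

Lemma rowv_norm_le (R : realType) d (h : 'rV[R]_d) e :
  0 <= e -> (forall i, `|h 0 i| <= e) -> `|h| <= e.
Proof.
move=> e0 he; rewrite [leLHS]/Num.norm/= mx_normrE; apply/bigmax_leP; split => //.
by case=> i j _ /=; rewrite (ord1 i).
Qed.

(** Go from [x] to [x + h] parallel to the axes, one coordinate at a time. On each edge the mean
    value theorem replaces the increment by a partial derivative at a point near [x], which is close
    to the partial derivative at [x] by continuity. *)
Lemma C1_linear_approx (R : realType) d (f : 'rV[R]_d -> R) (x : 'rV[R]_d) :
  (\forall y \near x, forall i, derivable f y (delta_mx 0 i)) ->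
  (forall i, {for x, continuous ('D_(delta_mx 0 i) f)}) ->
  forall e, 0 < e -> exists2 r, 0 < r & forall h : 'rV[R]_d, `|h| < r ->
    `|f (x + h) - f x - \sum_i h 0 i * 'D_(delta_mx 0 i) f x| <= e * `|h|.
Proof.
move=> fd fc.
have H e : 0 < e -> exists2 r, 0 < r & forall h : 'rV[R]_d, `|h| < r ->
    `|f (x + h) - f x - \sum_i h 0 i * 'D_(delta_mx 0 i) f x|
      <= (d%:R * e) * `|h|.
  move=> e0.
  have : \forall y \near x, forall i, derivable f y (delta_mx 0 i) /\
      `|'D_(delta_mx 0 i) f y - 'D_(delta_mx 0 i) f x| <= e.
    have /filter_forall hc : forall i, \forall y \near x,
        `|'D_(delta_mx 0 i) f y - 'D_(delta_mx 0 i) f x| <= e.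
      move=> i; have /cvgrPdist_le/(_ e e0) := fc i.
      by apply: filterS => y; rewrite distrC.
    by apply: filterS2 fd hc => y fdy hcy i; split.
  move=> /nbhs_ballP[r /= r0 Hr]; exists r => // h hr.
  (* The corners of the path: [y k] has received the coordinates of [h] of index less than [k], so
     that [y 0] is [x] and [y d] is [x + h]. *)
  pose y (k : nat) := x + \row_i (if (i < k)%N then h 0 i else 0).
  have yS (k : 'I_d) : y k.+1 = y k + h 0 k *: delta_mx 0 k.
    rewrite /y -addrA; congr (_ + _); apply/rowP => i; rewrite !mxE eqxx/=.
    rewrite ltnS leq_eqVlt -val_eqE/=.
    by case: ltngtP => [||/val_inj ->]; rewrite ?mulr0 ?addr0// ?mulr1 ?add0r.
  have step (k : 'I_d) :
      `|f (y k.+1) - f (y k) - h 0 k * 'D_(delta_mx 0 k) f x| <= e * `|h|.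
    have yb s : `|s| < r -> ball x r (y k + s *: delta_mx 0 k).
      move=> sr; rewrite -ball_normE/= /y opprD addrA opprD addrA subrr sub0r.
      rewrite -opprD normrN; apply: rowv_norm_lt => // i.
      rewrite !mxE eqxx/=; case: ltngtP => [||/val_inj->].
      - move=> ik; rewrite (_ : i == k = false) ?mulr0 ?addr0.
          exact: le_lt_trans (rowv_norm_coord _ _) hr.
        by rewrite -val_eqE/= ltn_eqF.
      - move=> ik; rewrite (_ : i == k = false) ?mulr0 ?addr0 ?normr0//.
        by rewrite -val_eqE/= gtn_eqF.
      - by rewrite eqxx mulr1 add0r.
    have hk : `|h 0 k| < r by exact: le_lt_trans (rowv_norm_coord _ _) hr.
    have [c ch] := @mean_value_abs R (fun s => f (y k + s *: delta_mx 0 k))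
       (fun s => 'D_(delta_mx 0 k) f (y k + s *: delta_mx 0 k)) r (h 0 k) hk
       (fun s sr => is_derive_line (Hr _ (yb s sr) k).1).
    rewrite scale0r addr0 -yS => ->; rewrite mulrC -mulrBr normrM mulrC.
    apply: ler_pM => //; last exact: rowv_norm_coord.
    by apply: (Hr _ _ k).2; apply: yb; apply: le_lt_trans hk.
  have y0 : y 0%N = x.
    by rewrite /y (_ : \row__ _ = 0) ?addr0//; apply/rowP => i; rewrite !mxE.
  have yd : y d = x + h.
    by rewrite /y; congr (_ + _); apply/rowP => i; rewrite !mxE ltn_ord.
  have -> : f (x + h) - f x - \sum_i h 0 i * 'D_(delta_mx 0 i) f x =
      \sum_(k < d) (f (y k.+1) - f (y k) - h 0 k * 'D_(delta_mx 0 k) f x).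
    rewrite sumrB; congr (_ - _).
    by rewrite -(big_mkord xpredT (fun k => f (y k.+1) - f (y k)))
       telescope_sumr ?leq0n// yd y0.
  apply: le_trans (ler_norm_sum _ _ _) _.
  apply: le_trans (ler_sum _ (fun k _ => step k)) _.
  by rewrite sumr_const card_ord mulr_natl mulrnAl.
(* The [d] edges cost a factor [d]; dividing by [d + 1] absorbs it and stays meaningful for
   [d = 0]. *)
move=> e e0; have [|r r0 Hr] := H (e / (d%:R + 1)).
  by rewrite divr_gt0// ltr_wpDl.
exists r => // h /Hr/le_trans; apply; apply: ler_wpM2r => //.
by rewrite mulrCA ger_pMr// ler_pdivrMr ?ltr_wpDl// mul1r lerDl.
Qed.

(** Differentiability at [x]; vectors being rows, [D] is the transpose of the usual Jacobian
    matrix. *)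
Definition linear_approx (R : realType) d e (f : 'rV[R]_d -> 'rV[R]_e)
    (x : 'rV[R]_d) (D : 'M[R]_(d, e)) : Prop :=
  forall eps, 0 < eps -> exists2 r, 0 < r & forall h : 'rV[R]_d, `|h| < r ->
    `|f (x + h) - f x - h *m D| <= eps * `|h|.

Lemma Cinfty_linear_approx (R : realType) d e (U : set 'rV[R]_d)
    (f : 'rV[R]_d -> 'rV[R]_e) x :
  open U -> Cinfty U f -> U x -> exists D, linear_approx f x D.
Proof.
move=> oU fU Ux.
have dcoord y v j : U y -> derivable (fun z => f z 0 j) y v /\
    'D_v (fun z => f z 0 j) y = ('D_v f y) 0 j.
  move=> Uy; have [_ /(_ v) fd] := fU [::] y Uy.
  have cv : (fun h : R => h^-1 *: (f (h *: v + y) 0 j - f y 0 j)) @ 0^' -->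
      ('D_v f y) 0 j.
    have -> : (fun h : R => h^-1 *: (f (h *: v + y) 0 j - f y 0 j)) =
       (fun M : 'rV[R]_e => M 0 j) \o
         (fun h : R => h^-1 *: (f (h *: v + y) - f y)).
      by apply/funext => h /=; rewrite !mxE.
    apply: continuous_cvg; first exact: coord_continuous.
    exact: fd.
  split; first by apply/cvg_ex; eexists; exact: cv.
  by apply/cvg_lim => //; exact: cv.
exists (\matrix_(i, j) ('D_(delta_mx 0 i) f x) 0 j) => eps e0.
have H (j : 'I_e) : exists2 r, 0 < r & forall h : 'rV[R]_d, `|h| < r ->
    `|f (x + h) 0 j - f x 0 j - \sum_i h 0 i * ('D_(delta_mx 0 i) f x) 0 j|
      <= eps * `|h|.
  have [||r r0 Hr] := @C1_linear_approx R d (fun z => f z 0 j) x _ _ eps e0.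
  - apply: filterS (open_nbhs_nbhs (conj oU Ux)) => y Uy i.
    by have [] := dcoord y (delta_mx 0 i) j Uy.
  - move=> i.
    have cD : {for x, continuous (fun y => ('D_(delta_mx 0 i) f y) 0 j)}.
      have [cf _] := fU [:: delta_mx 0 i] x Ux.
      apply: (@continuous_comp _ _ _ ('D_(delta_mx 0 i) f)
        (fun M : 'rV[R]_e => M 0 j)); [exact: cf|exact: coord_continuous].
    rewrite /prop_for /continuous_at (dcoord _ _ _ Ux).2.
    apply: cvg_trans cD; apply: near_eq_cvg.
      exact: nbhs_filter.
    have : \forall y \near x, U y by exact: open_nbhs_nbhs.
    by apply: filterS => y Uy; rewrite (dcoord _ _ _ Uy).2.
  exists r => // h /Hr.
  by under eq_bigr do rewrite (dcoord _ _ _ Ux).2.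
have [r Hr] := choice (fun j => let: ex_intro2 r r0 Hr := H j in
  ex_intro (fun r => 0 < r /\ _) r (conj r0 Hr)).
(* The default value 1 keeps the radius positive when there is no coordinate. *)
exists (\big[Num.min/1]_j r j).
  by apply/bigmin_gtP; split => // j _; have [] := Hr j.
move=> h /bigmin_gtP[_ hr]; apply: rowv_norm_le; first by rewrite mulr_ge0// ltW.
move=> j; have [_ /(_ h (hr j isT))] := Hr j.
by congr (`| _ | <= _); rewrite !mxE; congr (_ - _); apply: eq_bigr => i _; rewrite mxE.
Qed.

(** The velocity at 0 from the right. One side is all that makes sense for curves that leave a
    boundary point into an orthant or into a polytope. *)
Definition right_tangent (R : realType) d (g : R -> 'rV[R]_d) (w : 'rV[R]_d) :=
  forall eps, 0 < eps -> exists2 r, 0 < r & forall t, 0 < t < r ->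
    `|g t - g 0 - t *: w| <= eps * t.

Lemma right_tangent_line (R : realType) d (x v : 'rV[R]_d) :
  right_tangent (fun t => x + t *: v) v.
Proof.
move=> e e0; exists 1 => // t /andP[t0 _].
by rewrite scale0r addr0 addrAC addrK subrr normr0 mulr_ge0 ?ltW.
Qed.

Lemma mulmx_norm_bound (R : realType) d e (D : 'M[R]_(d, e)) :
  exists2 C, 0 < C & forall h : 'rV[R]_d, `|h *m D| <= C * `|h|.
Proof.
exists (1 + \sum_i \sum_j `|D i j|).
  by rewrite ltr_pwDl// sumr_ge0// => i _; rewrite sumr_ge0.
move=> h; apply: rowv_norm_le => [|j].
  by rewrite mulr_ge0// addr_ge0// sumr_ge0// => i _; rewrite sumr_ge0.
rewrite mxE; apply: le_trans (ler_norm_sum _ _ _) _.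
rewrite mulrDl mul1r mulr_suml; apply: ler_wpDl => //.
apply: ler_sum => i _; rewrite normrM mulrC; apply: ler_pM => //.
  by rewrite (bigD1 j)//= lerDl sumr_ge0.
exact: rowv_norm_coord.
Qed.

(** The chain rule: half of [eps] pays for the linearization of [f], the other half for the error on
    the velocity of [g] once it is mapped by [D]. *)
Lemma right_tangent_comp (R : realType) d e (f : 'rV[R]_d -> 'rV[R]_e)
    (g : R -> 'rV[R]_d) w D :
  right_tangent g w -> linear_approx f (g 0) D ->
  right_tangent (f \o g) (w *m D).
Proof.
move=> gw fD eps e0; have [C C0 HC] := mulmx_norm_bound D.
(* A Lipschitz constant at 0: the error on the velocity of [g] is taken at most 1, whence
   [|g t - g 0| <= K * t]. *)
pose K := `|w| + 1.
have K0 : 0 < K by rewrite ltr_wpDl.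
have [|r1 r10 Hr1] := fD (eps / (K * 2)); first by rewrite divr_gt0// mulr_gt0.
have [|r2 r20 Hr2] := gw (Num.min 1 (eps / (C * 2))).
  by rewrite lt_min ltr01 divr_gt0// mulr_gt0.
exists (Num.min r2 (r1 / K)); first by rewrite lt_min r20 divr_gt0.
move=> t /andP[t0]; rewrite lt_min => /andP[tr2 tr1].
have := Hr2 t; rewrite t0 tr2 => /(_ isT) gt.
pose h := g t - g 0.
have hK : `|h| <= K * t.
  rewrite /h -[X in `|X|](subrK (t *: w)); apply: le_trans (ler_normD _ _) _.
  rewrite normrZ (gtr0_norm t0) mulrDl mul1r addrC mulrC lerD2l.
  apply: le_trans gt _; rewrite ger_pMl//; by rewrite ge_min lexx.
have hr1 : `|h| < r1.
  by apply: le_lt_trans hK _; rewrite mulrC -ltr_pdivlMr.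
have hE : g 0 + h = g t by rewrite /h addrC subrK.
have := Hr1 _ hr1; rewrite hE => fh.
have -> : (f \o g) t - (f \o g) 0 - t *: (w *m D) =
  (f (g t) - f (g 0) - h *m D) + (h - t *: w) *m D.
  by rewrite (mulmxBl h) -scalemxAl addrA subrK.
apply: le_trans (ler_normD _ _) _; rewrite [eps]splitr mulrDl; apply: lerD.
  apply: le_trans fh _.
  apply: le_trans (ler_wpM2l _ hK) _; first by rewrite divr_ge0 ?mulr_ge0 ?ltW.
  rewrite mulrA ler_wpM2r ?(ltW t0)//.
  by rewrite (_ : eps / (K * 2) * K = eps / 2)//; field; rewrite gt_eqF.
apply: le_trans (HC _) _; apply: le_trans (ler_wpM2l (ltW C0) gt) _.
rewrite mulrA ler_wpM2r ?(ltW t0)//.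
apply: le_trans (ler_wpM2l (ltW C0) (_ : _ <= eps / (C * 2))) _.
  by rewrite ge_min lexx orbT.
by rewrite (_ : C * (eps / (C * 2)) = eps / 2)//; field; rewrite gt_eqF.
Qed.

Lemma right_tangent_ge0 (R : realType) d (g : R -> 'rV[R]_d) w (c : 'cV[R]_d) r :
  right_tangent g w -> 0 < r ->
  (forall t, 0 < t < r -> 0 <= ((g t - g 0) *m c) 0 0) ->
  0 <= (w *m c) 0 0.
Proof.
move=> gw r0 gc; have [C C0 HC] := mulmx_norm_bound c.
rewrite leNgt; apply/negP => wc.
(* With this tolerance the error, once paired with [c], is at most half of the supposedly negative
   main term, and so cannot make up for it. *)
have [|r1 r10 Hr1] := gw (- (w *m c) 0 0 / (C * 2)).
  by rewrite divr_gt0 ?oppr_gt0// mulr_gt0.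
pose t := Num.min r r1 / 2.
have t0 : 0 < t by rewrite divr_gt0// lt_min r0.
have tm : t < Num.min r r1 by rewrite ltr_pdivrMr// ltr_pMr ?lt_min ?r0// ltr1n.
move: tm; rewrite lt_min => /andP[tr tr1].
have := gc t; rewrite t0 tr => /(_ isT) gct.
have := Hr1 t; rewrite t0 tr1 => /(_ isT) gt.
have := le_trans (rowv_norm_coord _ 0) (HC (g t - g 0 - t *: w)).
rewrite mulmxBl -scalemxAl mxE [X in _ + X]mxE [X in _ - X]mxE => h.
have {}h := le_trans h (ler_wpM2l (ltW C0) gt).
have : C * (- (w *m c) 0 0 / (C * 2) * t) = - (w *m c) 0 0 / 2 * t.
  by field; rewrite gt_eqF.
move=> E; move: h; rewrite E => h.
have := le_trans (ler_norm _) h.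
have : 0 < - (w *m c) 0 0 * t by rewrite mulr_gt0// oppr_gt0.
move: gct; set A := ((g t - g 0) *m c) 0 0; set B := (w *m c) 0 0.
move=> A0 B0 AB; lra.
Qed.

Lemma right_tangent_uniq (R : realType) d (g : R -> 'rV[R]_d) w v r :
  right_tangent g w -> 0 < r -> (forall t, 0 < t < r -> g t = g 0 + t *: v) ->
  w = v.
Proof.
move=> gw r0 gv; apply/eqP; rewrite -subr_eq0 -normr_eq0; apply/negPn/negP => wv.
have wv0 : 0 < `|w - v| by rewrite lt0r wv/=.
have [|r1 r10 Hr1] := gw (`|w - v| / 2); first by rewrite divr_gt0.
pose t := Num.min r r1 / 2.
have t0 : 0 < t by rewrite divr_gt0// lt_min r0.
have tm : t < Num.min r r1 by rewrite ltr_pdivrMr// ltr_pMr ?lt_min ?r0// ltr1n.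
move: tm; rewrite lt_min => /andP[tr tr1].
have := Hr1 t; rewrite t0 tr1 gv ?t0// => /(_ isT).
rewrite (addrC (g 0)) addrK -scalerBr normrZ (gtr0_norm t0) distrC mulrC.
by rewrite ler_pM2r// leNgt gtr_pMr// invf_lt1// ltr1n.
Qed.

Lemma mulmx_continuous_at (R : realType) d e (X : topologicalType)
    (f : X -> 'rV[R]_d) (D : 'M[R]_(d, e)) (x : X) :
  {for x, continuous f} -> {for x, continuous (fun z => f z *m D)}.
Proof.
move=> fx; have [C C0 HC] := mulmx_norm_bound D.
apply/cvgrPdist_lt => eps e0.
have /cvgrPdist_lt/(_ (eps / C)) := fx; rewrite divr_gt0// => /(_ isT).
apply: filterS => y xy; rewrite -mulmxBl; apply: le_lt_trans (HC _) _.
by rewrite mulrC -ltr_pdivlMr.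
Qed.

(** * Polytopes and their facets *)

(** The body repeats the set in [polytope] literally, so that a polytope is a [hull] by
    conversion. *)
Definition hull (R : realType) n l (v : 'I_l -> 'rV[R]_n) : set 'rV[R]_n :=
  [set x | exists w : 'I_l -> R,
      [/\ forall i, 0 <= w i, \sum_i w i = 1 & x = \sum_i w i *: v i]].

Lemma hull_vertex (R : realType) n l (v : 'I_l -> 'rV[R]_n) k : hull v (v k).
Proof.
exists (fun j => (j == k)%:R); split.
- by move=> j; rewrite ler0n.
- by rewrite (bigD1 k)//= eqxx big1 ?addr0// => j /negbTE->.
- rewrite (bigD1 k)//= eqxx scale1r big1 ?addr0// => j /negbTE->.
  by rewrite scale0r.
Qed.

Lemma hull_convex (R : realType) n l (v : 'I_l -> 'rV[R]_n) x y t :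
  hull v x -> hull v y -> 0 <= t <= 1 -> hull v (x + t *: (y - x)).
Proof.
move=> [w [w0 w1 xE]] [z [z0 z1 yE]] /andP[t0 t1].
exists (fun i => (1 - t) * w i + t * z i); split.
- by move=> i; rewrite addr_ge0// mulr_ge0// subr_ge0.
- by rewrite big_split/= -!mulr_sumr w1 z1 !mulr1 subrK.
- under eq_bigr do rewrite scalerDl -!scalerA.
  rewrite big_split/= -!scaler_sumr -xE -yE scalerBr scalerBl scale1r.
  by rewrite addrA addrAC.
Qed.

Lemma hull_sub_ge0 (R : realType) n l (v : 'I_l -> 'rV[R]_n) p (c : 'cV[R]_n) x :
  (forall k, 0 <= ((v k - p) *m c) 0 0) -> hull v x ->
  0 <= ((x - p) *m c) 0 0.
Proof.
move=> vc [w [w0 w1 ->]].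
have -> : \sum_i w i *: v i - p = \sum_i w i *: (v i - p).
  under [RHS]eq_bigr do rewrite scalerBr.
  by rewrite sumrB -scaler_suml w1 scale1r.
rewrite mulmx_suml summxE; apply: sumr_ge0 => k _.
by rewrite -scalemxAl mxE mulr_ge0.
Qed.

(** The covectors nonnegative on all [v k - p] form the dual of the tangent cone at [p]. By
    hypothesis [M2] maps this dual cone into the nonnegative orthant and sends [u = col i M1] to the
    [i]-th basis vector, which spans an extreme ray. Hence a covector vanishing wherever [u] does
    among the [v k - p] is a multiple of [u], which forces the zero set of [u] to have codimension
    one. The sign of [- col i M1] comes from [face], which maximizes a functional. *)
Lemma hull_facet (R : realType) n l (v : 'I_l -> 'rV[R]_n) (p : 'rV[R]_n)
    (M1 M2 : 'M[R]_n) (i : 'I_n) :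
  hull v p -> M2 *m M1 = 1%:M ->
  (forall k, 0 <= ((v k - p) *m col i M1) 0 0) ->
  (forall c : 'cV[R]_n, (forall k, 0 <= ((v k - p) *m c) 0 0) ->
     forall j, 0 <= (M2 *m c) j 0) ->
  facet (hull v)
    [set x | hull v x /\ (x *m - col i M1) 0 0 = (p *m - col i M1) 0 0].
Proof.
move=> Pp M21 hu hc; set u := col i M1; set Phi := [set x | _].
have u_delta : M2 *m u = delta_mx i 0.
  by rewrite /u colE mulmxA M21 mul1mx.
pose al k := ((v k - p) *m u) 0 0.
have al0 k : 0 <= al k by exact: hu.
(* Points off the supporting hyperplane give zero rows, so the row space of [D] is the direction
   space of the face. *)
pose D := \matrix_(k < l) (if al k == 0 then v k - p else 0).
have rowD k : row k D = if al k == 0 then v k - p else 0 by rewrite rowK.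
have Du : D *m u = 0.
  apply/row_matrixP => k; rewrite row_mul rowD row0; case: eqP => [alk|_].
    by apply/rowP => j; rewrite (ord1 j) [LHS]alk mxE.
  by rewrite mul0mx.
have kerD (w : 'cV[R]_n) : D *m w = 0 -> exists mu, w = mu *: u.
  move=> Dw; pose be k := ((v k - p) *m w) 0 0.
  have be0 k : al k = 0 -> be k = 0.
    move=> alk; have := congr1 (row k) Dw; rewrite row_mul rowD alk eqxx row0.
    by move=> E; rewrite /be E mxE.
  (* Chosen so that [eps = 1 / (1 + S)] gives [eps * |be k| <= al k] for all [k]: then both
     [u + eps *: w] and [u - eps *: w] stay in the dual cone. If [al k = 0], then [be k = 0] and the
     term is 0. *)
  pose S := \sum_k `|be k| / al k.
  have S0 : 0 <= S by apply: sumr_ge0 => k _; rewrite divr_ge0 ?al0.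
  pose eps := (1 + S)^-1.
  have e0 : 0 < eps by rewrite invr_gt0 ltr_pwDl.
  have ebe k : eps * `|be k| <= al k.
    have [/be0 ->|alk] := eqVneq (al k) 0; first by rewrite normr0 mulr0 al0.
    have alk0 : 0 < al k by rewrite lt0r alk al0.
    rewrite /eps mulrC ler_pdivrMr ?ltr_pwDl// mulrC -ler_pdivrMr//.
    apply: (@le_trans _ _ S); last by rewrite lerDr.
    by rewrite /S (bigD1 k)//= lerDl sumr_ge0// => j _; rewrite divr_ge0 ?al0.
  have Hw (s : R) : `|s| = eps -> forall j, j != i -> 0 <= s * (M2 *m w) j 0.
    move=> se j ji.
    have : 0 <= (M2 *m (u + s *: w)) j 0.
      apply: hc => k.
      have -> : ((v k - p) *m (u + s *: w)) 0 0 = al k + s * be k.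
        by rewrite mulmxDr -scalemxAr [LHS]mxE [X in _ + X]mxE.
      rewrite -lerBlDr sub0r; apply: le_trans _ (ebe k).
      by rewrite -se -normrM -normrN ler_norm.
    by rewrite mulmxDr -scalemxAr mxE u_delta mxE (negbTE ji) add0r mxE.
  (* Applied with both signs of [eps], [Hw] makes every entry of [M2 *m w] other than the [i]-th
     both nonnegative and nonpositive. *)
  have Mw : M2 *m w = (M2 *m w) i 0 *: (M2 *m u).
    rewrite u_delta; apply/colP => j; rewrite [RHS]mxE [delta_mx _ _ _ _]mxE.
    rewrite eqxx andbT; have [->|ji] := eqVneq j i; first by rewrite mulr1.
    rewrite mulr0; have := Hw eps (gtr0_norm e0) j ji.
    have := Hw (- eps) _ j ji; rewrite normrN (gtr0_norm e0) => /(_ erefl).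
    rewrite mulNr oppr_ge0 !(pmulr_rle0, pmulr_rge0)// => h1 h2.
    by apply/eqP; rewrite eq_le h1.
  exists ((M2 *m w) i 0); have := congr1 (mulmx M1) Mw.
  by rewrite -scalemxAr !mulmxA (mulmx1C M21) !mul1mx.
have u0 : u != 0.
  apply/eqP => uE; have := u_delta; rewrite uE mulmx0 => /matrixP/(_ i 0).
  by rewrite !mxE !eqxx/= => /eqP; rewrite eq_sym oner_eq0.
have rkD : (\rank D).+1 = n.
  (* The rows of [kermx D^T] are the transposed covectors killed by [D]: all multiples of [u], and
     [u] is a nonzero one. *)
  have : \rank (kermx D^T) = 1%N.
    apply/eqP; rewrite eqn_leq; apply/andP; split.
      apply: (@leq_trans (\rank u^T)); last exact: rank_leq_row.
      apply/mxrankS/row_subP => k.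
      have : D *m (row k (kermx D^T))^T = 0.
        have := congr1 trmx (congr1 (row k) (mulmx_ker D^T)).
        by rewrite row_mul trmx_mul trmxK row0 trmx0.
      move=> /kerD[mu E]; rewrite -[row _ _]trmxK E linearZ/=.
      exact: scalemx_sub.
    rewrite lt0n mxrank_eq0; apply: contra u0 => /eqP K0.
    have : (u^T <= kermx D^T)%MS by apply/sub_kermxP; rewrite -trmx_mul Du trmx0.
    by rewrite K0 submx0 => /eqP/(congr1 trmx); rewrite trmxK trmx0 => ->.
  rewrite mxrank_ker mxrank_tr => h.
  by rewrite -{2}(subnK (rank_leq_col D)) h.
have decomp x : hull v x -> exists w : 'I_l -> R,
    (forall k, 0 <= w k) /\ x - p = \sum_k w k *: (v k - p).
  move=> [w [w0 w1 xE]]; exists w; split => //.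
  under eq_bigr do rewrite scalerBr.
  by rewrite sumrB -xE -scaler_suml w1 scale1r.
have uE x : ((x - p) *m u) 0 0 = (p *m - u) 0 0 - (x *m - u) 0 0.
  by rewrite mulmxBl !mulmxN !mxE; ring.
have sumE (w : 'I_l -> R) x : x - p = \sum_k w k *: (v k - p) ->
    ((x - p) *m u) 0 0 = \sum_k w k * al k.
  move=> ->; rewrite mulmx_suml summxE; apply: eq_bigr => k _.
  by rewrite -scalemxAl mxE.
split.
  exists (- u), ((p *m - u) 0 0); split => // x Px.
  by rewrite -subr_ge0 -uE; exact: hull_sub_ge0 hu Px.
(* A maximal free family of rows of [D]: each row is 0 or some [v k - p] with [v k] on the face, so
   translating [p] by it stays on the face. *)
exists (\rank D); split => //; exists p, (rowsub (maxrankfun D) D); split.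
- by split.
- exact: maxrowsub_free.
- move=> k; rewrite row_rowsub rowD; case: eqP => [alk|_]; last first.
    by rewrite addr0; split.
  rewrite addrC subrK; split; first exact: hull_vertex.
  by apply/eqP; rewrite eq_sym -subr_eq0 -uE; apply/eqP.
- move=> x [/decomp[w [w0 xE]] xu]; rewrite eq_maxrowsub xE.
  (* On the face the nonnegative terms [w k * al k] sum to 0, so only the points of the hyperplane
     carry weight. *)
  have wal k : w k * al k = 0.
    have := sumE w x xE; rewrite uE xu subrr => /esym/eqP.
    rewrite psumr_eq0; last by move=> j _; rewrite mulr_ge0 ?al0.
    by move=> /allP/(_ k (mem_index_enum _))/eqP.
  apply: summx_sub => k _.
  have [alk|/negbTE alk] := eqVneq (al k) 0.
    by apply: scalemx_sub; have := rowD k; rewrite alk eqxx => <-; apply: row_sub.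
  by have /eqP := wal k; rewrite mulf_eq0 alk orbF => /eqP->; rewrite scale0r sub0mx.
Qed.

(** [G] reads [P] near [p] in orthant coordinates and [g] goes back. Their derivatives [M1] and [M2]
    at [p] and [a] satisfy the hypotheses of [hull_facet], as first-order consequences of two facts:
    [G] is nonnegative on [P] near [p], and [g] maps short segments issued from [a] along the
    positive axes into [P]. *)
Lemma boundary_facet (R : realType) n (P U V : set 'rV[R]_n) (p a : 'rV[R]_n)
    (G g : 'rV[R]_n -> 'rV[R]_n) i :
  polytope P -> P p -> open U -> Cinfty U G -> U p ->
  open V -> Cinfty V g -> V a -> g a = p ->
  (forall l, exists2 r, 0 < r & forall t, 0 <= t < r ->
     P (g (a + t *: delta_mx 0 l)) /\
     G (g (a + t *: delta_mx 0 l)) = a + t *: delta_mx 0 l) ->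
  (exists2 r, 0 < r & forall x, P x -> `|x - p| < r -> forall j, 0 <= G x 0 j) ->
  a 0 i = 0 ->
  exists2 Fc, facet P Fc & Fc p.
Proof.
move=> [m [v PE]]; have {PE}-> : P = hull v by [].
move=> Pp oU GU Up oV gV Va gap hg [rG rG0 hG] ai0.
have [M1 HM1] := Cinfty_linear_approx oU GU Up.
have [M2 HM2] := Cinfty_linear_approx oV gV Va.
pose e (l : 'I_n) : 'rV[R]_n := delta_mx 0 l.
pose ga l t := g (a + t *: e l).
have ga0 l : ga l 0 = p by rewrite /ga scale0r addr0.
have tga l : right_tangent (ga l) (e l *m M2).
  apply: (right_tangent_comp (right_tangent_line a (e l))).
  by rewrite scale0r addr0.
(* [G \o ga l] is a straight segment with velocity [e l], while the chain rule gives it the velocity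
   [e l *m M2 *m M1]. *)
have M21 : M2 *m M1 = 1%:M.
  apply/row_matrixP => l; rewrite row_mul row1 rowE.
  have [r r0 hr] := hg l.
  apply: (@right_tangent_uniq _ _ (G \o ga l) _ _ r) => //.
    by apply: right_tangent_comp => //; rewrite ga0.
  move=> t /andP[t0 tr]; rewrite /= /ga.
  rewrite (hr t _).2 ?ltW// (hr 0 _).2 ?lexx//.
  by rewrite scale0r addr0.
have Gp : G p 0 i = 0.
  have [r r0 hr] := hg i; have := (hr 0 _).2; rewrite lexx r0 scale0r addr0.
  by rewrite gap => ->.
exists [set x | hull v x /\ (x *m - col i M1) 0 0 = (p *m - col i M1) 0 0]; last first.
  by split.
apply: (hull_facet Pp M21) => [k|c hc j].
  rewrite colE mulmxA.
  pose line t := p + t *: (v k - p).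
  have line0 : line 0 = p by rewrite /line scale0r addr0.
  have tl : right_tangent (G \o line) ((v k - p) *m M1).
    apply: right_tangent_comp; first exact: right_tangent_line.
    by rewrite -/(line 0) line0.
  (* The bound 1 keeps the segment from [p] to [v k] in the hull, the other bound keeps it in the
     ball where [G] is nonnegative. *)
  apply: (@right_tangent_ge0 _ _ _ _ _ (Num.min 1 (rG / (`|v k - p| + 1))) tl).
    by rewrite lt_min ltr01 divr_gt0// ltr_wpDl.
  move=> t /andP[t0]; rewrite lt_min => /andP[t1].
  rewrite ltr_pdivlMr ?ltr_wpDl// => tr.
  rewrite -colE mxE [X in 0 <= X]mxE [X in _ + X]mxE /= line0 Gp subr0.
  apply: hG.
    by apply: hull_convex => //; [exact: hull_vertex|rewrite !ltW].
  rewrite addrC addKr normrZ (gtr0_norm t0); apply: le_lt_trans tr.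
  by rewrite ler_wpM2l ?(ltW t0)// lerDl.
(* The [j]-th entry of [M2 *m c] is the value of [c] on the velocity of [ga j], a curve that starts
   at [p] and runs in the hull. *)
have [r r0 hr] := hg j.
have -> : (M2 *m c) j 0 = (e j *m M2 *m c) 0 0.
  by rewrite -mulmxA -rowE [RHS]mxE.
apply: (right_tangent_ge0 (tga j) r0) => t /andP[t0 tr].
rewrite ga0; apply: (hull_sub_ge0 hc).
by apply: (hr t _).1; rewrite ltW.
Qed.

(** * Compactness of a polytope and points off its facets *)

Lemma hull_compact (R : realType) n l (v : 'I_l -> 'rV[R]_n) : compact (hull v).
Proof.
pose S := [set w : 'rV[R]_l | (forall i, 0 <= w 0 i) /\ \sum_i w 0 i = 1].
(* A hull is the linear image of the standard simplex, which is closed and bounded. *)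
have -> : hull v = (fun w : 'rV[R]_l => w *m \matrix_i v i) @` S.
  apply/seteqP; split => [x [w [w0 w1 ->]]|_ [w [w0 w1] <-]].
    exists (\row_i w i).
      by split=> [i|]; [rewrite mxE|under eq_bigr do rewrite mxE].
    by rewrite mulmx_sum_row; apply: eq_bigr => i _; rewrite mxE rowK.
  exists (fun i => w 0 i); split => //.
  by rewrite mulmx_sum_row; apply: eq_bigr => i _; rewrite rowK.
apply: continuous_compact.
  apply: continuous_subspaceT => w.
  by apply: (@mulmx_continuous_at _ _ _ _ id) => //; exact: cvg_id.
apply: bounded_closed_compact.
  exists 1; split => // B B1 w [w0 w1]; apply: le_trans (ltW B1).
  apply: rowv_norm_le => // i; rewrite ger0_norm// -w1 (bigD1 i)//= lerDl.
  by apply: sumr_ge0.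
have -> : S = (\bigcap_(i in [set: 'I_l]) [set w : 'rV[R]_l | 0 <= w 0 i]) `&`
    [set w : 'rV[R]_l | (w *m const_mx 1 : 'rV[R]_1) 0 0 = 1].
  have sE (w : 'rV[R]_l) : (w *m const_mx 1 : 'rV[R]_1) 0 0 = \sum_i w 0 i.
    by rewrite mxE; apply: eq_bigr => i _; rewrite mxE mulr1.
  apply/seteqP; split => w /=; rewrite sE => -[w0 w1]; split => // i.
    by move=> _; exact: w0.
  exact: w0.
apply: closedI.
  apply: closed_bigI => i _.
  apply: (@preimage_closed _ _ (fun w : 'rV[R]_l => w 0 i) [set x | 0 <= x]).
    by move=> w _; exact: coord_continuous.
  exact: closed_ge.
apply: (@preimage_closed _ _ (fun w : 'rV[R]_l => (w *m const_mx 1 : 'rV[R]_1) 0 0)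
  [set 1]); last exact: closed_eq.
move=> w _; apply: (@continuous_comp _ _ _ (fun w : 'rV[R]_l => w *m const_mx 1)
  (fun y : 'rV[R]_1 => y 0 0)); last exact: coord_continuous.
by apply: (@mulmx_continuous_at _ _ _ _ id) => //; exact: cvg_id.
Qed.

(** Otherwise the [n] independent directions of [P] would lie in the row space of a matrix with
    [n - 1] rows. *)
Lemma affine_dim_facet (R : realType) n (P : set 'rV[R]_n) :
  affine_dim P n -> ~ facet P P.
Proof.
move=> [x0 [B [Px0 Bfree PB _]]] [_ [r [rn [x1 [B' [_ _ _ PB']]]]]].
have : (B <= B')%MS.
  apply/row_subP => i; have -> : row i B = (x0 + row i B - x1) - (x0 - x1).
    by rewrite opprB addrA subrK addrC addKr.
  apply: addmx_sub; first exact: PB' (PB i).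
  by rewrite -scaleN1r; apply: scalemx_sub; exact: PB'.
move=> /mxrankS; rewrite (eqP Bfree) => nB'.
have := leq_trans nB' (rank_leq_row B').
by rewrite -rn ltnn.
Qed.

(** The barycentre of the [v i]: a functional attaining its maximum there attains it at each [v i],
    hence on all of [P], and no facet is [P]. *)
Lemma hull_center (R : realType) n l (v : 'I_l -> 'rV[R]_n) :
  affine_dim (hull v) n -> exists2 c, hull v c & forall G, facet (hull v) G -> ~ G c.
Proof.
move=> dimP; have l0 : (0 < l)%N.
  have [x0 [_ [[w [_ w1 _]] _ _ _]]] := dimP.
  case: (posnP l) w1 => // l0; subst l.
  by rewrite big_ord0 => /esym/eqP; rewrite oner_eq0.
have lR : (l%:R : R) != 0 by rewrite pnatr_eq0 -lt0n.
exists (\sum_i l%:R^-1 *: v i).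
  exists (fun=> l%:R^-1); split => //.
  by rewrite sumr_const card_ord -[LHS]mulr_natr mulVf.
move=> G fG Gc; have [[a [b [Pb GE]]] _] := fG.
suff GP : G = hull v by apply: (affine_dim_facet dimP); rewrite -{2}GP.
have vb i : (v i *m a) 0 0 = b.
  move: Gc; rewrite GE => -[_]; rewrite mulmx_suml summxE.
  under eq_bigr do rewrite -scalemxAl mxE.
  rewrite -mulr_sumr => /(congr1 (fun x => l%:R * x)); rewrite mulVKf// => sb.
  have : \sum_i (b - (v i *m a) 0 0) == 0.
    by rewrite sumrB sumr_const card_ord sb mulr_natl subrr.
  rewrite psumr_eq0; last by move=> j _; rewrite subr_ge0; apply: Pb; exact: hull_vertex.
  by move=> /allP/(_ i (mem_index_enum _)); rewrite subr_eq0 => /eqP.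
rewrite GE; apply/seteqP; split => [x [] //|x Px]; split => //.
case: (Px) => w [w0 w1 ->]; rewrite mulmx_suml summxE.
under eq_bigr do rewrite -scalemxAl mxE vb.
by rewrite -mulr_suml w1 mul1r.
Qed.

(** The functional of the facet is smaller than its maximum at [c], and so at every convex
    combination giving [c] a positive weight. *)
Lemma facet_segment (R : realType) n (P : set 'rV[R]_n) G c x t :
  facet P G -> P c -> ~ G c -> P x -> 0 <= t < 1 -> ~ G (c + t *: (x - c)).
Proof.
move=> [[a [b [Pb GE]]] _] Pc; rewrite GE => nGc Px /andP[t0 t1] [_].
have cb : (c *m a) 0 0 < b.
  by rewrite lt_neqAle Pb// andbT; apply/eqP => e; apply: nGc.
have xb := Pb x Px.
rewrite mulmxDl -scalemxAl mulmxBl mxE [X in _ + X]mxE [X in _ + _ * X]mxE.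
rewrite [X in _ + _ * (_ + X)]mxE; move: xb cb.
set u := (x *m a) 0 0; set w := (c *m a) 0 0 => ub wb E.
have : 0 < (1 - t) * (b - w) by rewrite mulr_gt0 ?subr_gt0.
have : 0 <= t * (b - u) by rewrite mulr_ge0 ?subr_ge0.
by nra.
Qed.

(** * Topology of tori and of C^n x T^k *)

Lemma normc_eq1 (R : realType) (z : R[i]) :
  (`|z| = 1) <-> (complex.Re z ^+ 2 + complex.Im z ^+ 2 = 1).
Proof.
split=> [z1|z1]; last by rewrite normc_def z1 sqrtr1.
by apply: (@complexI R); rewrite add_Re2_Im2 z1 expr1n.
Qed.

Lemma complex_ReM (R : realType) (z w : R[i]) : complex.Re (z * w) =
  complex.Re z * complex.Re w - complex.Im z * complex.Im w.
Proof. by case: z; case: w. Qed.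

Lemma complex_ImM (R : realType) (z w : R[i]) : complex.Im (z * w) =
  complex.Re z * complex.Im w + complex.Im z * complex.Re w.
Proof. by case: z; case: w. Qed.

Lemma normc1_ReIm (R : realType) (z w : R[i]) : `|z| = 1 -> `|w| = 1 ->
  complex.Re z = complex.Re w -> z = w \/ z = w^-1.
Proof.
move=> z1 w1 zw; have w1' : w^-1 = w^*.
  have w0 : w != 0 by rewrite -normr_eq0 w1 oner_eq0.
  apply: (mulfI w0); rewrite mulfV//; move/normc_eq1 : w1.
  case: w {zw w0} => a b /= ab; apply/eqP; rewrite eq_complex/=.
  by rewrite mulrN opprK -!expr2 ab mulrN mulrC addrC subrr !eqxx.
move/normc_eq1 : z1 zw; move/normc_eq1 : w1 w1'.
case: z w => a b [c d] /= cd -> ab ac; subst c.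
have : (b - d) * (b + d) == 0.
  by rewrite -subr_sqr subr_eq0; apply/eqP; apply: (addrI (a ^+ 2)); rewrite cd.
rewrite mulf_eq0 subr_eq0 addr_eq0 => /orP[|]/eqP->; first by left.
by right.
Qed.

Lemma normc1_Re_le1 (R : realType) (z : R[i]) : `|z| = 1 -> complex.Re z <= 1.
Proof.
move=> /normc_eq1; set a := complex.Re z; set b := complex.Im z => ab.
by have := sqr_ge0 b; nra.
Qed.

(** With [x] the cosine of an angle, the right-hand side is [2 (1 - x) (1 + x)]: doubling an angle
    of positive cosine at least doubles the distance of the cosine to 1. *)
Lemma double_angle_growth (R : realFieldType) (x : R) :
  0 < x -> x <= 1 -> (1 - x) * 2 <= 1 - (x ^+ 2 *+ 2 - 1).
Proof. by move=> x0 x1; nra. Qed.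

(* A subgroup of the circle containing a path from 1 to another point is the
   whole circle: doubling an angle repeatedly makes the real part negative, so
   that the path meets every point of the right half circle up to conjugation,
   and every point of the circle is the square of such a point. *)
Lemma circle_hom_onto (R : realType) (psi : R -> R[i]) (s0 : R) :
  (forall s t, psi (s + t) = psi s * psi t) -> (forall s, `|psi s| = 1) ->
  continuous (fun s => complex.Re (psi s)) -> psi s0 != 1 ->
  forall z, `|z| = 1 -> exists s, psi s = z.
Proof.
move=> psiD psi1 xc s01.
pose x s := complex.Re (psi s).
have nz s : psi s != 0 by rewrite -normr_eq0 psi1 oner_eq0.
have psi0 : psi 0 = 1 by apply: (mulfI (nz 0)); rewrite -psiD addr0 mulr1.
have psiN s : psi (- s) = (psi s)^-1.
  by apply: (mulfI (nz s)); rewrite -psiD subrr psi0 mulfV.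
have xdbl s : x (s + s) = x s ^+ 2 *+ 2 - 1.
  rewrite /x psiD complex_ReM; have /normc_eq1 := psi1 s; set a := complex.Re _.
  set b := complex.Im _ => ab; rewrite -!expr2 mulr2n -[X in _ = _ - X]ab; ring.
have xle1 s : x s <= 1.
  exact: normc1_Re_le1.
have [s1 s1x] : exists s, x s <= 0.
  apply: contrapT => /forallNP xpos.
  have {}xpos s : 0 < x s by rewrite ltNge; apply/negP; exact: xpos.
  pose d0 := 1 - x s0.
  have d0_gt0 : 0 < d0.
    rewrite subr_gt0 lt_neqAle xle1 andbT; apply: contra s01 => /eqP xs0.
    have [->//|] := @normc1_ReIm R (psi s0) 1 (psi1 s0) (normr1 _) xs0.
    by rewrite invr1 => ->.
  (* The doubling yields a factor [2 ^ k]; this linear lower bound already contradicts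
     [1 - x s < 1]. *)
  have grow k : exists s, d0 * k.+1%:R <= 1 - x s.
    elim: k => [|k [s hs]]; first by exists s0; rewrite mulr1.
    exists (s + s); rewrite xdbl; apply: (@le_trans _ _ ((1 - x s) * 2)).
      apply: le_trans (ler_wpM2r _ hs) => //.
      by rewrite -mulrA ler_wpM2l ?(ltW d0_gt0)//
         -natrM ler_nat muln2 -addnn addSn ltnS addnS leq_addr.
    exact: double_angle_growth.
  pose K := Num.bound d0^-1; have [s hs] := grow K.
  have hK : d0^-1 < K.+1%:R.
    apply: (@lt_le_trans _ _ K%:R); last by rewrite ler_nat.
    by apply: archi_boundP; rewrite invr_ge0 ltW.
  have h : 1 < d0 * K.+1%:R by rewrite -ltr_pdivrMl// mulr1.
  by have := lt_le_trans h hs; rewrite ltrBrDl gtrDr ltNge (ltW (xpos s)).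
have xhalf y : 0 <= y <= 1 -> exists s, x s = y.
  move=> /andP[y0 y1].
  have x0 : x 0 = 1 by rewrite /x psi0.
  have [s10|s10] := leP 0 s1.
    have [||s _ <-] := @IVT R x 0 s1 y s10; last by exists s.
      exact: continuous_subspaceT.
    by rewrite x0 ge_min le_max y1 (le_trans s1x y0) orbT.
  have [||s _ <-] := @IVT R x s1 0 y (ltW s10); last by exists s.
    exact: continuous_subspaceT.
  by rewrite x0 ge_min le_max y1 (le_trans s1x y0) orbT.
have half z : `|z| = 1 -> 0 <= complex.Re z -> exists s, psi s = z.
  move=> z1 Rez; have [|s xs] := xhalf (complex.Re z).
    by rewrite Rez normc1_Re_le1.
  have [|] := normc1_ReIm (psi1 s) z1 xs; first by exists s.
  by move=> sz; exists (- s); rewrite psiN sz invrK.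
(* One of the two square roots [w] and [- w] has a nonnegative real part, so [half] reaches it. *)
move=> z z1; pose w := sqrtc z.
have w1 : `|w| = 1.
  apply/eqP; rewrite -(@eqrXn2 _ 2) ?ler01// expr1n -normrX sqr_sqrtc z1.
  by rewrite eqxx.
have [w0|w0] := leP 0 (complex.Re w).
  have [s sw] := half w w1 w0; exists (s + s).
  by rewrite psiD sw -expr2 sqr_sqrtc.
have [||s sw] := half (- w); first by rewrite normrN.
  by case: (w) w0 => a b /= a0; rewrite oppr_ge0 ltW.
by exists (s + s); rewrite psiD sw -expr2 sqrrN sqr_sqrtc.
Qed.

Definition cis (R : realType) (s : R) : R[i] := cos s +i* sin s.

Lemma cisD (R : realType) (s t : R) : cis (s + t) = cis s * cis t.
Proof.
by apply/eqP; rewrite eq_complex/= cosD sinD eqxx/= addrC mulrC [X in _ + X]mulrC mulrC.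
Qed.

Lemma cis_norm (R : realType) (s : R) : `|cis s| = 1.
Proof. by apply/normc_eq1; rewrite /= cos2Dsin2. Qed.

Lemma cis0 (R : realType) : cis (0 : R) = 1.
Proof. by rewrite /cis cos0 sin0. Qed.

Lemma cisMz (R : realType) (s : R) (k : int) : cis s ^ k = cis (s *~ k).
Proof.
have nz : cis s != 0 by rewrite -normr_eq0 cis_norm oner_eq0.
have H m : cis s ^+ m = cis (s *+ m).
  elim: m => [|m IH]; first by rewrite mulr0n cis0 expr0.
  by rewrite exprS IH mulrS cisD.
case: k => m; first exact: H.
rewrite -[LHS]/((cis s ^+ m.+1)^-1) -[s *~ _]/(- (s *+ m.+1)) H.
have nzm : cis (s *+ m.+1) != 0 by rewrite -normr_eq0 cis_norm oner_eq0.
apply: (mulfI nzm); rewrite mulfV// -cisD.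
by rewrite subrr cis0.
Qed.

(** * Continuity by coordinates, initial topologies and compactness *)

Lemma row_continuous_at (R : realType) n (X : topologicalType)
    (f : X -> 'rV[R]_n) (x : X) :
  (forall j, {for x, continuous (fun z => f z 0 j)}) -> {for x, continuous f}.
Proof.
move=> fj; apply/cvgrPdist_lt => e e0.
have /filter_forall H : forall j, \forall z \near x, `|f x 0 j - f z 0 j| < e.
  by move=> j; have /cvgrPdist_lt/(_ e e0) := fj j.
apply: filterS H => z H; apply: rowv_norm_lt => // j.
by have := H j; rewrite !mxE.
Qed.

Lemma initial_continuous_at (S : choiceType) (T X : topologicalType) (g : S -> T)
    (f : X -> initial_topology g) (x : X) :
  {for x, continuous (g \o f)} -> {for x, continuous f}.
Proof.
move=> gf W; rewrite nbhsE/= => -[W' [[B Bo BO] Ox] OW].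
rewrite nbhs_simpl; have : nbhs (g (f x)) B.
  by apply: open_nbhs_nbhs; split => //; move: Ox; rewrite -BO.
move=> /gf; rewrite !nbhs_simpl; apply: (@filterS _ (nbhs x)) => z /= Bz.
by apply: OW; rewrite -BO.
Qed.

(** A filter is pushed forward by [g], and a cluster point [g a] of the image pulls back to [a],
    since each neighborhood of [a] contains the preimage of an open set around [g a]. *)
Lemma initial_compact (S : choiceType) (T : topologicalType) (g : S -> T)
    (A : set S) : compact (g @` A) -> compact (A : set (initial_topology g)).
Proof.
move=> cA F FF FA; have gF : (g @ F) (g @` A).
  by rewrite nbhs_simpl; apply: (@filterS _ F _ A) => // a Aa; exists a.
have [_ [[a Aa <-] ca]] := cA _ _ gF.
exists a; split => // B C FB; rewrite nbhsE/= => -[C' [[V Vo VO] Oa] OC].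
have gB : (g @ F) (g @` B).
  by rewrite nbhs_simpl; apply: (@filterS _ F _ B) => // b Bb; exists b.
have Va : nbhs (g a) V.
  by apply: open_nbhs_nbhs; split => //; move: Oa; rewrite -VO.
have [_ [[b Bb <-] Vb]] := ca _ _ gB Va.
by exists b; split => //; apply: OC; rewrite -VO.
Qed.

Lemma set_type_compact (T : topologicalType) (A : set T) :
  compact A -> compact [set: A].
Proof.
move=> cA; apply: initial_compact.
rewrite (_ : set_val @` _ = A)//; apply/seteqP; split.
  by move=> _ [a _ <-]; exact: set_valP.
by move=> a Aa; exists (SigSub (mem_set Aa)).
Qed.

Lemma sum_sq_continuous_at (R : realType) (X : topologicalType) (f g : X -> R)
    (x : X) : {for x, continuous f} -> {for x, continuous g} ->
  {for x, continuous (fun z => f z ^+ 2 + g z ^+ 2)}.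
Proof. by move=> fx gx; apply: cvgD; rewrite !expr2; apply: cvgM. Qed.

Section Cvec.
Variables (R : realType) (N : nat).

Lemma reimE (z : cvec R N) (i : 'I_N) : (reim z 0 (lshift N i) = complex.Re (z 0 i)) *
  (reim z 0 (rshift N i) = complex.Im (z 0 i)).
Proof. by rewrite /reim row_mxEl row_mxEr !mxE. Qed.

Lemma cvec_Re_continuous (i : 'I_N) :
  continuous (fun z : cvec R N => complex.Re (z 0 i)).
Proof.
move=> z; have -> : (fun z : cvec R N => complex.Re (z 0 i)) =
    (fun v : 'rV[R]_(N + N) => v 0 (lshift N i)) \o @reim R N.
  by apply/funext => w /=; rewrite reimE.
apply: continuous_comp; last exact: coord_continuous.
exact: initial_continuous.
Qed.

Lemma cvec_Im_continuous (i : 'I_N) :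
  continuous (fun z : cvec R N => complex.Im (z 0 i)).
Proof.
move=> z; have -> : (fun z : cvec R N => complex.Im (z 0 i)) =
    (fun v : 'rV[R]_(N + N) => v 0 (rshift N i)) \o @reim R N.
  by apply/funext => w /=; rewrite reimE.
apply: continuous_comp; last exact: coord_continuous.
exact: initial_continuous.
Qed.

Lemma cvec_continuous_at (X : topologicalType) (f : X -> cvec R N) (x : X) :
  (forall i, {for x, continuous (fun z => complex.Re (f z 0 i))}) ->
  (forall i, {for x, continuous (fun z => complex.Im (f z 0 i))}) ->
  {for x, continuous f}.
Proof.
move=> fR fI; apply: initial_continuous_at; apply: row_continuous_at => j.
rewrite -(splitK j); case: (fintype.split j) => i /=.
  rewrite (_ : (fun z => _) = (fun z => complex.Re (f z 0 i))); first exact: fR.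
  by apply/funext => z; rewrite reimE.
rewrite (_ : (fun z => _) = (fun z => complex.Im (f z 0 i))); first exact: fI.
by apply/funext => z; rewrite reimE.
Qed.

Lemma torus_continuous_at (X : topologicalType) (f : X -> torus R N) (x : X) :
  (forall i, {for x, continuous (fun z => complex.Re (Defs.tval (f z) 0 i))}) ->
  (forall i, {for x, continuous (fun z => complex.Im (Defs.tval (f z) 0 i))}) ->
  {for x, continuous f}.
Proof.
move=> fR fI.
by apply: (@initial_continuous_at _ _ X _ f x); exact: cvec_continuous_at.
Qed.

Lemma torus_Re_continuous (i : 'I_N) :
  continuous (fun t : torus R N => complex.Re (Defs.tval t 0 i)).
Proof.
move=> t; apply: (@continuous_comp _ _ _ (fun t : torus R N => Defs.tval t : cvec R N)
  (fun z : cvec R N => complex.Re (z 0 i))); last exact: cvec_Re_continuous.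
exact: initial_continuous.
Qed.

Lemma torus_row (f : 'I_N -> R[i]) : (forall i, `|f i| = 1) ->
  exists t : torus R N, forall i, Defs.tval t 0 i = f i.
Proof.
move=> f1; have fP : (\row_i f i : cvec R N) \in @torus_set R N.
  by apply/mem_set => i; rewrite mxE.
exists (exist (fun z => z \in @torus_set R N) _ fP) => i.
by rewrite /Defs.tval/= set_valE/= mxE.
Qed.

(** The topology is initial twice, through the inclusion in C^N and through [reim], which reduces
    the claim to a closed bounded subset of R^2N. *)
Lemma torus_compact : compact [set: torus R N].
Proof.
apply: set_type_compact; apply: initial_compact.
apply: bounded_closed_compact.
  exists 1; split => // M M1 _ [z z1 <-]; apply: le_trans (ltW M1).
  apply: rowv_norm_le => // j; rewrite -(splitK j).
  have sq_le1 (a b : R) : a ^+ 2 + b ^+ 2 = 1 -> `|a| <= 1.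
    move=> ab; rewrite -(@ler_pXn2r _ 2)// ?nnegrE// expr1n real_normK ?num_real//.
    by rewrite -ab lerDl sqr_ge0.
  case: (fintype.split j) => i /=; rewrite reimE; have /normc_eq1 := z1 i.
    exact: sq_le1.
  by rewrite addrC; exact: sq_le1.
have -> : @reim R N @` @torus_set R N = \bigcap_(i in [set: 'I_N])
    [set v : 'rV[R]_(N + N) |
      v 0 (lshift N i) ^+ 2 + v 0 (rshift N i) ^+ 2 = 1].
  apply/seteqP; split => [_ [z z1 <-] i _|v v1] /=.
    by rewrite !reimE; apply/normc_eq1.
  exists (\row_i (v 0 (lshift N i) +i* v 0 (rshift N i))).
    by move=> i; rewrite mxE; apply/normc_eq1 => /=; exact: v1.
  apply/rowP => j; rewrite -(splitK j); case: (fintype.split j) => i /=.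
    by rewrite reimE mxE.
  by rewrite reimE mxE.
apply: closed_bigI => i _.
apply: (@preimage_closed _ _ (fun v : 'rV[R]_(N + N) =>
  v 0 (lshift N i) ^+ 2 + v 0 (rshift N i) ^+ 2) [set 1]); last exact: closed_eq.
by move=> v _; apply: sum_sq_continuous_at; exact: coord_continuous.
Qed.

End Cvec.

Section KStandard.
Variables (R : realType) (n k : nat).

Lemma sqmoduliE (z : cvec R (n + k)) i :
  `|z 0 (lshift k i)| ^+ 2 = (sqmoduli z 0 i)%:C.
Proof. by rewrite -add_Re2_Im2 mxE. Qed.

Lemma sqmoduli_ge0 (z : cvec R (n + k)) i : 0 <= sqmoduli z 0 i.
Proof. by rewrite mxE addr_ge0// sqr_ge0. Qed.

Lemma sqmoduli_eq0 (z : cvec R (n + k)) i :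
  (sqmoduli z 0 i == 0) = (z 0 (lshift k i) == 0).
Proof.
rewrite -[RHS]normr_eq0 -[RHS](@sqrf_eq0 R[i]) sqmoduliE.
by rewrite -(inj_eq (@complexI R)).
Qed.

Lemma sqmoduli_act t (z : cvec R (n + k)) :
  sqmoduli (kstandard_act t z) = sqmoduli z.
Proof.
apply/rowP => i; apply: (@complexI R).
by rewrite -!sqmoduliE mxE normrM tvalP mul1r.
Qed.

Lemma sqmoduli_continuous : continuous (@sqmoduli R n k).
Proof.
move=> z; apply: row_continuous_at => j.
rewrite (_ : (fun z => _) = (fun z : cvec R (n + k) =>
    complex.Re (z 0 (lshift k j)) ^+ 2 + complex.Im (z 0 (lshift k j)) ^+ 2)).
  apply: sum_sq_continuous_at; [exact: cvec_Re_continuous|].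
  exact: cvec_Im_continuous.
by apply/funext => w; rewrite mxE.
Qed.

Lemma same_sqmoduli_orbit (z w : cvec R (n + k)) :
  kstandard_space z -> kstandard_space w -> sqmoduli z = sqmoduli w ->
  exists t, w = kstandard_act t z.
Proof.
(* Where [z 0 i] is 0, so is [w 0 i], and any unit number would do; elsewhere the quotient is the
   only choice. *)
move=> zk wk zw; pose f i := if z 0 i == 0 then 1 else w 0 i / z 0 i.
have zwi i : `|z 0 i| = `|w 0 i|.
  rewrite -(splitK i); case: (fintype.split i) => j /=; last by rewrite zk wk.
  apply/eqP; rewrite -(@eqrXn2 _ 2)//; apply/eqP.
  by rewrite !sqmoduliE zw.
have f1 i : `|f i| = 1.
  rewrite /f; case: eqP => [_|/eqP z0]; first by rewrite normr1.
  by rewrite normf_div -zwi mulfV// normr_eq0.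
have [t tf] := torus_row f1; exists t; apply/rowP => i; rewrite mxE tf /f.
case: eqP => [z0|/eqP z0]; last by rewrite divfK.
have := zwi i; rewrite z0 normr0 mulr0 => /esym/eqP.
by rewrite normr_eq0 => /eqP.
Qed.

(* [phase 0 = 1], so that a zero coordinate can be moved away from [0]. *)
Definition phase (z : R[i]) : R[i] := if z == 0 then 1 else z / `|z|.

Lemma phase_norm z : `|phase z| = 1.
Proof.
rewrite /phase; case: eqP => [_|/eqP z0]; first by rewrite normr1.
by rewrite normf_div normr_id mulfV// normr_eq0.
Qed.

Lemma phaseK z : `|z| * phase z = z.
Proof.
rewrite /phase; case: eqP => [->|/eqP z0]; first by rewrite normr0 mul0r.
by rewrite mulrCA mulfV ?mulr1// normr_eq0.
Qed.

(** For [t] and [b] nonnegative, a lift starting at [z] of the ray [sqmoduli z + t *: b]; the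
    arguments stay fixed. *)
Definition inflate (z : cvec R (n + k)) (b : 'rV[R]_n) (t : R) : cvec R (n + k) :=
  \row_i match fintype.split i with
    | inl j => (Num.sqrt (sqmoduli z 0 j + t * b 0 j))%:C * phase (z 0 i)
    | inr _ => z 0 i end.

Lemma inflate_l z b t (j : 'I_n) : inflate z b t 0 (lshift k j) =
  (Num.sqrt (sqmoduli z 0 j + t * b 0 j))%:C * phase (z 0 (lshift k j)).
Proof. by rewrite mxE (unsplitK (inl _ j)). Qed.

Lemma inflate_r z b t (j : 'I_k) :
  inflate z b t 0 (rshift n j) = z 0 (rshift n j).
Proof. by rewrite mxE (unsplitK (inr _ j)). Qed.

Lemma inflate0 z b : inflate z b 0 = z.
Proof.
apply/rowP => i; rewrite -(splitK i); case: (fintype.split i) => j /=.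
  rewrite inflate_l mul0r addr0 -[RHS]phaseK; congr (_ * _).
  by rewrite mxE normc_def.
by rewrite inflate_r.
Qed.

Lemma inflate_kstandard z b t : kstandard_space z -> kstandard_space (inflate z b t).
Proof. by move=> zk j; rewrite inflate_r. Qed.

Lemma inflate_sqmoduli (z : cvec R (n + k)) (b : 'rV[R]_n) (t : R) :
  0 <= t -> (forall j, 0 <= b 0 j) ->
  sqmoduli (inflate z b t) = sqmoduli z + t *: b.
Proof.
move=> t0 b0; apply/rowP => j; apply: (@complexI R); rewrite -sqmoduliE.
have h : 0 <= sqmoduli z 0 j + t * b 0 j.
  by rewrite addr_ge0 ?sqmoduli_ge0// mulr_ge0.
rewrite inflate_l normrM phase_norm mulr1 ger0_norm ?ler0c ?sqrtr_ge0//.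
by rewrite -rmorphXn/= sqr_sqrtr// [X in _ = X%:C]mxE [X in _ = (_ + X)%:C]mxE.
Qed.

Lemma inflate_continuous z b : continuous (inflate z b).
Proof.
have sq j : continuous (fun t : R => Num.sqrt (sqmoduli z 0 j + t * b 0 j)).
  move=> t; apply: (@continuous_comp _ _ _ (fun t : R => sqmoduli z 0 j + t * b 0 j)
    (fun x : R => Num.sqrt x)); last exact: sqrt_continuous.
  apply: cvgD; first exact: cvg_cst.
  by apply: cvgM; [exact: cvg_id|exact: cvg_cst].
move=> t; apply: cvec_continuous_at => i; rewrite -(splitK i);
  case: (fintype.split i) => j /=.
- rewrite (_ : (fun t => _) = (fun t => Num.sqrt (sqmoduli z 0 j + t * b 0 j) *
      complex.Re (phase (z 0 (lshift k j))))); last first.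
    by apply/funext => u; rewrite inflate_l complex_ReM/= mul0r subr0.
  by apply: cvgM; [exact: sq|exact: cvg_cst].
- rewrite (_ : (fun t => _) = (fun=> complex.Re (z 0 (rshift n j)))).
    exact: cvg_cst.
  by apply/funext => u; rewrite inflate_r.
- rewrite (_ : (fun t => _) = (fun t => Num.sqrt (sqmoduli z 0 j + t * b 0 j) *
      complex.Im (phase (z 0 (lshift k j))))); last first.
    by apply/funext => u; rewrite inflate_l complex_ImM/= mul0r addr0.
  by apply: cvgM; [exact: sq|exact: cvg_cst].
- rewrite (_ : (fun t => _) = (fun=> complex.Im (z 0 (rshift n j)))).
    exact: cvg_cst.
  by apply/funext => u; rewrite inflate_r.
Qed.

End KStandard.

(** * Lifting the contraction of a polytope *)

Lemma continuous_comp_within (X Y Z : topologicalType) (f : X -> Y) (g : Y -> Z)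
    (D : set Y) (x : X) :
  {within D, continuous g} -> {for x, continuous f} ->
  (\forall z \near x, D (f z)) -> {for x, continuous (g \o f)}.
Proof.
move=> /subspace_continuousP gD fx Df W /= gW.
have /gD/(_ W gW) := nbhs_singleton Df; rewrite /within/= => /fx.
rewrite /= !nbhs_simpl => /= H.
by apply: filterS2 Df H => z Dz; apply.
Qed.

Lemma continuous_near_eq (X Y : topologicalType) (f g : X -> Y) (x : X) :
  {for x, continuous f} -> (\forall z \near x, g z = f z) ->
  {for x, continuous g}.
Proof.
move=> fx gf W; rewrite (nbhs_singleton gf) => /fx; rewrite !nbhs_simpl => H.
by apply: filterS2 gf H => z /= ->.
Qed.

Lemma continuous_pair (X Y Z : topologicalType) (f : X -> Y) (g : X -> Z) (x : X) :
  {for x, continuous f} -> {for x, continuous g} ->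
  {for x, continuous (fun z => (f z, g z))}.
Proof.
move=> fx gx W /= [[A B]/= [/fx Ax /gx Bx] AB]; rewrite !nbhs_simpl in Ax Bx *.
by apply: (@filterS2 _ (nbhs x) _ _ _ _ _ Ax Bx) => z Az Bz; apply: AB.
Qed.

Lemma continuous_line (R : realType) n (X : topologicalType) (c : 'rV[R]_n)
    (f : X -> 'rV[R]_n) (tau : X -> R) :
  continuous f -> continuous tau -> continuous (fun x => c + tau x *: (f x - c)).
Proof.
move=> fc tc x; apply: cvgD; first exact: cvg_cst.
by apply: cvgZ; [exact: tc|apply: cvgB; [exact: fc|exact: cvg_cst]].
Qed.

Lemma continuous_dist (R : realType) n (X : topologicalType) (p : 'rV[R]_n)
    (f : X -> 'rV[R]_n) : continuous f -> continuous (fun x => `|p - f x|).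
Proof.
by move=> fc x; apply: cvg_norm; apply: cvgB; [exact: cvg_cst|exact: fc].
Qed.

Lemma continuous_bump (R : realType) (X : topologicalType) (f : X -> R)
    (a b e k : R) :
  continuous f -> continuous (fun x => a + b * Num.min 1 ((e - f x) * k)).
Proof.
move=> fc x; apply: cvgD; first exact: cvg_cst.
apply: cvgM; first exact: cvg_cst.
apply: (@continuous_min R X (fun=> 1) (fun x => (e - f x) * k)).
  exact: cvg_cst.
apply: cvgM; last exact: cvg_cst.
by apply: cvgB; [exact: cvg_cst|exact: fc].
Qed.

(* Moving a point [y] to the fibre over a new base point is continuous only when
   the base point leaves the interior [I] of the orbit space, or stays put: the
   isotropy group may grow but not shrink. *)
Definition transport_domain (R : realType) n (M : Type) (q : M -> 'rV[R]_n)
    (P I : set 'rV[R]_n) (p : 'rV[R]_n) (eps : R) : set (M * 'rV[R]_n) :=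
  [set yp | [/\ ball p eps (q yp.1), ball p eps yp.2, P (q yp.1), P yp.2 &
     I (q yp.1) \/ yp.2 = q yp.1]].

(** The last clause, that nothing moves when the base point stays put, is what makes a locally
    transported lift glue with the old one. *)
Definition local_transport (R : realType) n (M : topologicalType)
    (q : M -> 'rV[R]_n) (P I : set 'rV[R]_n) (p : 'rV[R]_n) (eps : R)
    (tr : M * 'rV[R]_n -> M) : Prop :=
  [/\ {within transport_domain q P I p eps, continuous tr},
      forall yp, transport_domain q P I p eps yp -> q (tr yp) = yp.2 &
      forall y, P (q y) -> ball p eps (q y) -> tr (y, q y) = y].

(** The lift [s] over [r] is transported to [r'] on the open set [O] containing [K], and kept on the
    complement of [K]. These open sets cover [X], and on their overlap [r' = r], so the two formulas
    agree. *)
Lemma lift_step (R : realType) n (M X : topologicalType) (q : M -> 'rV[R]_n)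
    (P I : set 'rV[R]_n) p eps tr (r r' : X -> 'rV[R]_n) (s : X -> M)
    (K : set X) :
  local_transport q P I p eps tr ->
  continuous r -> continuous r' -> continuous s -> (forall x, q (s x) = r x) ->
  (forall x, P (r x)) -> (forall x, P (r' x)) ->
  (forall x, I (r x) \/ r' x = r x) ->
  closed K -> (forall x, ~ K x -> r' x = r x) ->
  (forall x, K x -> ball p eps (r x) /\ ball p eps (r' x)) ->
  exists2 s' : X -> M, continuous s' & forall x, q (s' x) = r' x.
Proof.
move=> [trc trq trid] rc r'c sc qs Pr Pr' Ir Kc Kr Kb.
pose O := [set x | ball p eps (r x) /\ ball p eps (r' x)].
have bo : open (ball p eps) by exact: ball_open.
have Oo : open O.
  by apply: openI; apply: open_comp=> //.
exists (fun x => if pselect (O x) then tr (s x, r' x) else s x); last first.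
  move=> x; case: pselect => [[b b']|nO].
    by rewrite trq//; split => //=; rewrite qs.
  by rewrite qs Kr// => /Kb.
move=> x; have [Ox|nOx] := pselect (O x).
  apply: (@continuous_near_eq _ _ (tr \o (fun z => (s z, r' z)))).
    apply: (continuous_comp_within trc).
      by apply: continuous_pair; [exact: sc|exact: r'c].
    apply: filterS (open_nbhs_nbhs (conj Oo Ox)) => z [b b'].
    by split => //=; rewrite qs.
  apply: filterS (open_nbhs_nbhs (conj Oo Ox)) => z Oz.
  by case: pselect.
have nKx : (~` K) x by move=> /Kb.
apply: (@continuous_near_eq _ _ s); first exact: sc.
have Ko : open (~` K) by exact: closed_openC.
apply: filterS (open_nbhs_nbhs (conj Ko nKx)) => z nKz.
case: pselect => //= -[b b'].
have -> : r' z = q (s z) by rewrite qs Kr.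
by apply: trid; rewrite qs.
Qed.

Section GlobalSection.
Variables (R : realType) (n : nat) (M : topologicalType) (q : M -> 'rV[R]_n).
Variables (P I : set 'rV[R]_n) (c : 'rV[R]_n).
Hypothesis cP : compact P.
Hypothesis starP : forall x t, P x -> 0 <= t <= 1 -> P (c + t *: (x - c)).
Hypothesis starI : forall x t, P x -> 0 <= t < 1 -> I (c + t *: (x - c)).

Definition homothety (x : P) (t : R) : 'rV[R]_n := c + t *: (set_val x - c).

(** The parameter [tau] varies with the point, so that regions of [P] can be advanced one after the
    other. *)
Definition liftable (tau : P -> R) : Prop :=
  exists2 s : P -> M, continuous s & forall x, q (s x) = homothety x (tau x).

Lemma set_val_continuous : continuous (set_val : P -> 'rV[R]_n).
Proof. exact: initial_continuous. Qed.

Lemma homothety_continuous (tau : P -> R) :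
  continuous tau -> continuous (fun x => homothety x (tau x)).
Proof. by move=> tc; apply: continuous_line => //; exact: set_val_continuous. Qed.

Lemma set_typeP (x : P) : P (set_val x).
Proof. exact: (set_mem (valP x)). Qed.

(** A point with [tau x = 1] does not move, because [sigma x <= 1], and any other
    [homothety x (tau x)] lies in [I]: exactly the alternative required by [transport_domain]. *)
Lemma liftable_max p eps tr (tau sigma : P -> R) (K : set P) :
  local_transport q P I p eps tr ->
  continuous tau -> continuous sigma ->
  (forall x, 0 <= tau x <= 1) -> (forall x, sigma x <= 1) ->
  closed K -> (forall x, ~ K x -> sigma x <= tau x) ->
  (forall x, K x -> ball p eps (homothety x (tau x)) /\
     ball p eps (homothety x (Num.max (tau x) (sigma x)))) ->
  liftable tau -> liftable (fun x => Num.max (tau x) (sigma x)).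
Proof.
move=> trp tc sc t01 s1 Kc Ks Kb [s scont qs].
have mc : continuous (fun x => Num.max (tau x) (sigma x)).
  by move=> x; apply: continuous_max; [exact: tc|exact: sc].
have m01 x : 0 <= Num.max (tau x) (sigma x) <= 1.
  by have /andP[t0 t1] := t01 x; rewrite le_max t0/= ge_max t1 s1.
apply: (lift_step trp _ _ scont qs _ _ _ Kc) => //.
- exact: homothety_continuous.
- exact: homothety_continuous.
- by move=> x; apply: starP; [exact: set_typeP|].
- by move=> x; apply: starP; [exact: set_typeP|].
- move=> x; have /andP[t0] := t01 x.
  rewrite le_eqVlt => /predU1P[t1|t1].
    by right; rewrite max_l// t1.
  by left; apply: starI; [exact: set_typeP|rewrite t0].
- by move=> x /Ks sx; rewrite max_l.
Qed.

Hypothesis loc : forall p, P p -> exists2 eps, 0 < eps &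
  exists tr, local_transport q P I p eps tr.
Hypothesis qc : exists y, q y = c.

Lemma finite_transport_cover : exists ps : seq ('rV[R]_n * R),
  (forall pe, pe \in ps -> 0 < pe.2 /\
      exists tr, local_transport q P I pe.1 pe.2 tr) /\
  forall x, P x -> exists2 pe, pe \in ps & `|pe.1 - x| <= pe.2 / 4.
Proof.
pose D := [set pe : 'rV[R]_n * R | 0 < pe.2 /\
   exists tr, local_transport q P I pe.1 pe.2 tr].
(* Quarter radii leave room for a cut-off between [eps / 4] and [eps / 2] and for a displacement
   less than [eps / 4]. *)
have := cP; rewrite compact_cover => /(_ _ D (fun pe => ball pe.1 (pe.2 / 4))).
case=> [pe _|x Px|ps psD Pps]; first exact: ball_open.
  have [eps e0 tre] := loc Px; exists (x, eps) => //=.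
  by apply: ballxx; rewrite divr_gt0.
exists (finmap.enum_fset ps); split => [pe /psD|x /Pps[pe peps]]; first by rewrite inE.
by rewrite -ball_normE/= => /ltW pex; exists pe.
Qed.

(** Induction on [j]. A time step [1 / N] moves every point by less than a quarter of each radius of
    the finite cover; within a step the balls are processed one by one, each raising [tau] by a bump
    function. *)
Lemma liftable_grid : exists N : nat, (0 < N)%N /\ forall j : nat, (j <= N)%N ->
  liftable (fun=> j%:R / N%:R).
Proof.
have [ps [psT psP]] := finite_transport_cover.
have [B B0 PB] : exists2 B, 0 < B & forall x, P x -> `|x - c| <= B.
  have := compact_bounded cP => -[b [_ Hb]].
  exists (`|b| + 1 + `|c| + 1) => [|x Px]; first by rewrite ltr_wpDl// !addr_ge0.
  apply: le_trans (ler_normB _ _) _; rewrite -addrA lerD// ?lerDl//.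
  by apply: Hb => //; apply: le_lt_trans (ler_norm _) _; rewrite ltrDl.
pose d := \big[Num.min/1]_(pe <- ps) (pe.2 / 4).
have d0 : 0 < d.
  rewrite /d big_seq; elim/big_ind: _ => // [x y x0 y0|pe /psT[pe0 _]].
    by rewrite lt_min x0.
  by rewrite divr_gt0.
have dle pe : pe \in ps -> d <= pe.2 / 4.
  rewrite /d; elim: (ps) => // pe' l IH; rewrite inE big_cons ge_min.
  by move=> /predU1P[->|/IH ->]; rewrite ?lexx ?orbT.
pose N := (Num.bound (B / d)).+1.
have N0 : 0 < N%:R :> R by rewrite ltr0n.
have BN : B / N%:R < d.
  rewrite ltr_pdivrMr// mulrC -ltr_pdivrMr//.
  apply: lt_trans (archi_boundP _) _; first by rewrite divr_ge0// ltW.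
  by rewrite ltr_nat.
exists N; split => //; elim => [_|j IH jN].
  (* At time 0 the contraction is constant, equal to [c], and a constant map lifts it. *)
  have [y qy] := qc; exists (fun=> y); first exact: cst_continuous.
  by move=> x; rewrite qy /homothety mul0r scale0r addr0.
pose t0 : R := j%:R / N%:R; pose t1 : R := j.+1%:R / N%:R.
have t01 : t1 = t0 + 1 / N%:R by rewrite /t1 -addn1 natrD mulrDl.
have t0ge : 0 <= t0 by rewrite divr_ge0.
have t1le : t1 <= 1 by rewrite ler_pdivrMr// mul1r ler_nat.
have t0t1 : t0 <= t1 by rewrite t01 lerDl divr_ge0.
have {}IH : liftable (fun=> t0) by apply: IH; exact: ltnW.
(* The invariant: the points whose position at time [t0] lies in a quarter ball listed in [l] have
   reached time [t1]. For the whole cover these are all the points of [P]. *)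
suff H (l : seq ('rV[R]_n * R)) : {subset l <= ps} -> exists tau : P -> R,
    [/\ continuous tau, forall x, t0 <= tau x <= t1, liftable tau &
      forall pe x, pe \in l -> `|pe.1 - homothety x t0| <= pe.2 / 4 -> tau x = t1].
  have [//|tau [tc tb [s sc qs] tE]] := H ps.
  exists s => // x; rewrite qs; congr homothety.
  have [|pe peps pex] := psP (homothety x t0).
    by apply: starP; [exact: set_typeP|rewrite t0ge (le_trans t0t1)].
  exact: tE pex.
elim: l => [_|pe l IHl lps].
  exists (fun=> t0); split => //; first exact: cst_continuous.
  by move=> x; rewrite lexx.
have [|tau [tc tb tl tE]] := IHl.
  by move=> x xl; apply: lps; rewrite inE xl orbT.
have peps : pe \in ps by apply: lps; rewrite inE eqxx.
have [e0 [tr trp]] := psT _ peps.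
set e := pe.2 in e0 trp; set p := pe.1 in trp.
pose dist x := `|p - homothety x t0|.
have dc : continuous dist.
  by apply: continuous_dist; apply: homothety_continuous; exact: cst_continuous.
(* The bump is [t1] where [dist x <= e / 4] and at most [t0] where [dist x >= e / 2]. *)
pose sigma x := t0 + N%:R^-1 * Num.min 1 ((e / 2 - dist x) * (4 / e)).
have sigc : continuous sigma by exact: continuous_bump.
have sig1 x : sigma x <= t1.
  by rewrite t01 lerD2l div1r ger_pMr ?invr_gt0// ge_min lexx.
exists (fun x => Num.max (tau x) (sigma x)); split.
- by move=> x; apply: continuous_max; [exact: tc|exact: sigc].
- by move=> x; have /andP[h1 h2] := tb x; rewrite le_max h1/= ge_max h2 sig1.
- apply: (liftable_max (K := [set x | dist x <= e / 2]) trp) => //.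
  + move=> x; have /andP[h1 h2] := tb x.
    by rewrite (le_trans t0ge h1) (le_trans h2 t1le).
  + by move=> x; apply: le_trans (sig1 x) t1le.
  + apply: (@preimage_closed _ _ dist [set y | y <= e / 2]) => [x _|].
      exact: dc.
    exact: closed_le.
  + move=> x /negP; rewrite -ltNge => xe; have /andP[h1 _] := tb x.
    apply: le_trans _ h1; rewrite gerDl pmulr_rle0 ?invr_gt0// ge_min.
    by rewrite pmulr_lle0 ?divr_gt0// subr_le0 (ltW xe) orbT.
  + move=> x xe.
    (* The distance to [p] is at most [e / 2] at time [t0], and the displacement is less than
       [e / 4]. *)
    have near_t u : t0 <= u <= t1 -> ball p e (homothety x u).
      move=> /andP[u0 u1]; rewrite -ball_normE/=.
      have -> : p - homothety x u = (p - homothety x t0) - (u - t0) *: (set_val x - c).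
        by rewrite /homothety scalerBl !opprD opprK !addrA [RHS]addrAC subrK.
      apply: le_lt_trans (ler_normB _ _) _.
      have h1 : `|(u - t0) *: (set_val x - c)| < e / 4.
        rewrite normrZ ger0_norm ?subr_ge0//.
        apply: le_lt_trans (lt_le_trans BN (dle _ peps)).
        rewrite mulrC ler_pM ?subr_ge0//; first exact: PB (set_typeP x).
        by rewrite lerBlDl -div1r -t01.
      apply: lt_le_trans (ler_ltD xe h1) _.
      have := e0; lra.
    have /andP[h1 h2] := tb x; split; apply: near_t; first by rewrite h1.
    by rewrite le_max h1/= ge_max h2 sig1.
- move=> pe' x; rewrite inE => /predU1P[->|pel] pex; last first.
    by rewrite (tE pe')// max_l.
  rewrite max_r.
    rewrite /sigma min_l ?mulr1 ?t01 ?div1r//.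
    rewrite mulrA ler_pdivlMr// mul1r -/e.
    by move: pex; rewrite -/(dist x) -/e => h; have := e0; lra.
  have /andP[_ h2] := tb x; apply: le_trans h2 _.
  rewrite t01 lerD2l div1r ler_peMr ?invr_ge0//.
  rewrite le_min lexx/= mulrA ler_pdivlMr// mul1r -/e.
  by move: pex; rewrite -/(dist x) -/e => h; have := e0; lra.
Qed.

Lemma global_section : exists2 s : P -> M, continuous s &
  forall x, q (s x) = set_val x.
Proof.
have [N [N0 /(_ N (leqnn N))[s sc qs]]] := liftable_grid.
exists s => // x.
by rewrite qs /homothety divff ?pnatr_eq0 -?lt0n// scale1r addrC subrK.
Qed.

End GlobalSection.

(** * Local models of the action *)

Lemma orbit_mapP (R : realType) N (M : topologicalType)
    (act : torus_action R N M) x y :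
  orbit_map act x = orbit_map act y <-> exists t, act t x = y.
Proof.
split=> [/eqmodP/asboolP//|xy].
by apply/eqmodP/asboolP.
Qed.

Lemma orbit_image_open (R : realType) N (M : topologicalType)
    (act : torus_action R N M) (U : set M) :
  open U -> (forall t x, U x -> U (act t x)) -> open (orbit_map act @` U).
Proof.
(* Openness in the quotient is by definition openness of the preimage, and [U] is saturated. *)
move=> oU Uinv; have -> : open (orbit_map act @` U) =
    open (orbit_map act @^-1` (orbit_map act @` U)) by [].
rewrite (_ : _ @^-1` _ = U)//; apply/seteqP; split => [x [y Uy]|x Ux].
  by move=> /orbit_mapP[t <-]; exact: Uinv.
by exists x.
Qed.

Section LocalModel.
Variables (R : realType) (n k : nat) (M : topologicalType).
Variables (A : set (chart R M (n.*2 + k))) (act : torus_action R (n + k) M).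
Hypothesis hM : locally_kstandard A act.
Variables (P : set 'rV[R]_n) (h : orbit_space act -> 'rV[R]_n).
Hypothesis hh :
  diffeomorphism (orbit_atlas A act) (@euclidean_atlas R n) setT P h.

Definition orbit_coord (x : M) : 'rV[R]_n := h (orbit_map act x).
Local Notation q := orbit_coord.

Lemma orbit_coord_eq x y : q x = q y <-> exists t, act t x = y.
Proof.
rewrite -orbit_mapP; split => [|xy]; last by rewrite /q xy.
by have [[_ hinj _] _ _] := hh; apply: hinj; rewrite inE.
Qed.

Lemma orbit_coord_act t x : q (act t x) = q x.
Proof. by congr h; apply/esym/orbit_mapP; exists t. Qed.

Lemma orbit_coordP x : P (q x).
Proof. by have [[hP _ _] _ _] := hh; apply: hP. Qed.

Lemma orbit_coord_onto p : P p -> exists x, q x = p.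
Proof.
have [[_ _ hs] _ _] := hh => /hs[y _ <-].
by exists (repr y); rewrite /q /orbit_map reprK.
Qed.

(* [psi] inverts the locally standard chart [phi] on [U]; [G] and [g] are smooth
   extensions of the map of orthant-valued coordinates [q x |-> |phi x|^2] and of
   its inverse. *)
Record local_model (x0 : M) (U : set M)
    (theta : torus R (n + k) -> torus R (n + k)) (phi : M -> cvec R (n + k))
    (psi : cvec R (n + k) -> M) (W : set (cvec R (n + k)))
    (UG : set 'rV[R]_n) (G : 'rV[R]_n -> 'rV[R]_n)
    (V : set 'rV[R]_n) (g : 'rV[R]_n -> 'rV[R]_n) (eps : R) : Prop :=
  LocalModel {
    lm_base : U x0;
    lm_inv : forall t x, U x -> U (act t x);
    lm_theta : torus_automorphism theta;
    lm_W : open W;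
    lm_image : phi @` U = W `&` @kstandard_space R n k;
    lm_phi : forall x, U x -> {for x, continuous phi};
    lm_psi : {within phi @` U, continuous psi};
    lm_phiK : forall x, U x -> psi (phi x) = x;
    lm_act : forall t x, U x -> phi (act t x) = kstandard_act (theta t) (phi x);
    lm_UG : open UG;
    lm_G : Cinfty UG G;
    lm_eps : 0 < eps;
    lm_ballG : ball (q x0) eps `<=` UG;
    lm_ball : forall x, ball (q x0) eps (q x) ->
      [/\ U x, G (q x) = sqmoduli (phi x) & V (sqmoduli (phi x))];
    lm_V : open V;
    lm_g : Cinfty V g;
    lm_Vbase : V (sqmoduli (phi x0));
    lm_qg : forall x, U x -> V (sqmoduli (phi x)) ->
      q x = g (sqmoduli (phi x)) }.

Lemma local_modelP x0 : exists U theta phi psi W UG G V g eps,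
  local_model x0 U theta phi psi W UG G V g eps.
Proof.
have [_ _ _ /(_ x0)[U [theta [phi [Ux0 Uchart]]]]] := hM.
have [[oU Uinv] thaut [W oW phiU] [_ [phic _] [psi [phiK [psic _]]]] phiact] := Uchart.
(* The representative may be any point of the orbit: [sqmoduli] is constant on orbits inside [U]. *)
pose c : chart R (orbit_space act) n :=
  Chart (orbit_map act @` U) (fun o => sqmoduli (phi (repr o))).
have cE x : U x -> c (orbit_map act x) = sqmoduli (phi x).
  move=> Ux; rewrite /c/=.
  have /orbit_mapP[t <-] : orbit_map act x = orbit_map act (repr (orbit_map act x)).
    by rewrite {2}/orbit_map reprK.
  by rewrite phiact// sqmoduli_act.
have cA : orbit_atlas A act c by exists U, theta, phi.
have cU x : chart_dom c (orbit_map act x) -> U x.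
  by move=> [y Uy /orbit_mapP[t <-]]; exact: Uinv.
have [_ [_ hs] [kk [hK [kkc ks]]]] := hh.
pose b : chart R 'rV[R]_n n := Chart setT idfun.
have kq x : kk (q x) = orbit_map act x by rewrite hK// inE.
have cx0 : chart_dom c (orbit_map act x0) by exists x0.
(* In the charts [c] and [b], [h] extends to the smooth map [g], and its inverse [kk] to the smooth
   map [G]. *)
have [V [g [oV Vx0 gV Vg]]] := hs c b (orbit_map act x0) cA erefl I cx0 I.
have [|UG [G [oUG UGx0 GG UGG]]] := ks b c (q x0) erefl cA (orbit_coordP x0) I.
  by rewrite kq.
have : \forall p \near q x0, P p -> (orbit_map act @` U) (kk p).
  move/subspace_continuousP : kkc => /(_ _ (orbit_coordP x0)) kkc.
  have Unear : nbhs (kk (q x0)) (orbit_map act @` U).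
    rewrite kq; apply: open_nbhs_nbhs; split => //; exact: orbit_image_open.
  exact: kkc Unear.
have : nbhs (q x0) UG by exact: open_nbhs_nbhs.
have Gq x : UG (q x) -> chart_dom c (kk (q x)) -> G (q x) = sqmoduli (phi x).
  move=> UGx; rewrite kq => /cU Ux; rewrite -cE// -kq.
  by rewrite -(UGG (q x))//= ?kq//; [exact: orbit_coordP|exists x].
have : nbhs (q x0) (G @^-1` V).
  have [Gc _] := GG [::] _ UGx0; apply: Gc; apply: open_nbhs_nbhs; split => //=.
  by rewrite Gq ?kq// -cE.
move=> /nbhs_ballP[e3 /= e30 be3] /nbhs_ballP[e1 /= e10 be1].
move=> /nbhs_ballP[e2 /= e20 be2].
(* On the ball of radius [e], [G] is defined ([e1]), points of [P] come from [U] ([e2]), and [G]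
   takes its values in [V] ([e3]). *)
pose e := Num.min e3 (Num.min e1 e2).
exists U, theta, phi, psi, W, UG, G, V, g, e.
have bmin p : ball (q x0) e p ->
    [/\ ball (q x0) e1 p, ball (q x0) e2 p & ball (q x0) e3 p].
  by move=> bp; split; apply: le_ball bp; rewrite /e !ge_min lexx ?orbT.
split => //.
- move=> x Ux; move: phic; rewrite continuous_open_subspace// => phic.
  by apply: phic; rewrite inE.
- by move=> x Ux; apply: phiK; rewrite inE.
- by rewrite !lt_min e30 e10.
- by move=> p /bmin[/be1].
- move=> x /bmin[/be1 UGx /be2/(_ (orbit_coordP x)) kx /be3 Vx].
  rewrite -Gq//; split => //; apply: cU; rewrite -kq; exact: kx.
- by rewrite -cE.
- by move=> x Ux; rewrite -cE// => Vx; apply: (Vg (orbit_map act x)) => //; exists x.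
Qed.

Section Model.
Variables (x0 : M) (U : set M) (theta : torus R (n + k) -> torus R (n + k)).
Variables (phi : M -> cvec R (n + k)) (psi : cvec R (n + k) -> M).
Variables (W : set (cvec R (n + k))) (UG : set 'rV[R]_n).
Variables (G : 'rV[R]_n -> 'rV[R]_n) (V : set 'rV[R]_n).
Variables (g : 'rV[R]_n -> 'rV[R]_n) (eps : R).
Hypothesis H : local_model x0 U theta phi psi W UG G V g eps.

(** The same chart serves around nearby points, where different coordinates may vanish; only the
    ball shrinks. *)
Lemma model_rebase x : ball (q x0) eps (q x) ->
  exists eps', local_model x U theta phi psi W UG G V g eps'.
Proof.
move=> bx; exists (eps - `|q x0 - q x|).
have sub p : ball (q x) (eps - `|q x0 - q x|) p -> ball (q x0) eps p.
  rewrite -!ball_normE/= => h1; rewrite -(subrKA (q x)).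
  by apply: le_lt_trans (ler_normD _ _) _; rewrite -ltrBrDl.
case: H => *; split => //.
- by have [] := lm_ball H bx.
- by move: bx; rewrite -ball_normE/= subr_gt0.
- by move=> p /sub/(lm_ballG H).
- by move=> y /sub/(lm_ball H).
- by have [] := lm_ball H bx.
Qed.

Lemma model_image z : W z -> kstandard_space z ->
  exists2 x, U x & phi x = z.
Proof.
move=> Wz kz; have : (phi @` U) z by rewrite (lm_image H).
by move=> [x Ux <-]; exists x.
Qed.

Lemma model_kstandard x : U x -> kstandard_space (phi x).
Proof.
move=> Ux; have : (phi @` U) (phi x) by exists x.
by rewrite (lm_image H) => -[].
Qed.

(** For small [t] the inflated point remains in [W], hence in the image of the chart, by continuity
    in [t]; so the ray in the orthant is realized by points of [M]. *)
Lemma model_curve (b : 'rV[R]_n) (B : set 'rV[R]_n) :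
  (forall j, 0 <= b 0 j) -> nbhs (q x0) B ->
  exists2 r, 0 < r & forall t, 0 <= t < r -> exists x,
    [/\ U x, phi x = inflate (phi x0) b t,
        q x = g (sqmoduli (phi x0) + t *: b) & B (q x)].
Proof.
move=> b0 B0; have Ux0 := lm_base H.
pose z := phi x0; have zk : kstandard_space z by exact: model_kstandard.
have zW : W z.
  have : (phi @` U) z by exists x0.
  by rewrite (lm_image H) => -[].
have ic := @inflate_continuous R n k z b 0.
have sc : {for 0, continuous (fun t => sqmoduli (inflate z b t))}.
  by apply: continuous_comp; [exact: ic|exact: sqmoduli_continuous].
have gx0 : q x0 = g (sqmoduli z) by apply: (lm_qg H) => //; exact: lm_Vbase H.
have [gc _] := lm_g H [::] (lm_Vbase H).
have Wn : \forall t \near (0 : R), W (inflate z b t).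
  by apply: ic; rewrite inflate0; apply: open_nbhs_nbhs; split => //; exact: lm_W H.
have Vn : \forall t \near (0 : R), V (sqmoduli (inflate z b t)).
  apply: sc; rewrite /= inflate0; apply: open_nbhs_nbhs; split.
    exact: lm_V H.
  exact: lm_Vbase H.
have Bn : \forall t \near (0 : R), B (g (sqmoduli (inflate z b t))).
  have gs : {for 0, continuous (g \o (fun t => sqmoduli (inflate z b t)))}.
    by apply: continuous_comp => //; rewrite inflate0.
  by apply: gs; rewrite /= inflate0 -gx0.
have : nbhs (0 : R) [set t | [/\ W (inflate z b t), V (sqmoduli (inflate z b t)) &
    B (g (sqmoduli (inflate z b t)))]].
  by apply: filterS3 Wn Vn Bn => t ? ? ?; split.
move=> /nbhs_ballP[r /= r0 Hr].
exists r => // t /andP[t0 tr].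
have [|Wt Vt Bt] := Hr t.
  by rewrite -ball_normE/= sub0r normrN ger0_norm.
have [x Ux xE] := model_image Wt (@inflate_kstandard R n k z b t zk).
have qE : q x = g (sqmoduli (inflate z b t)).
  by rewrite -xE; apply: (lm_qg H) => //; rewrite xE.
exists x; split => //; last by rewrite qE.
by rewrite qE inflate_sqmoduli.
Qed.

(** [boundary_facet] at [sqmoduli (phi x0)]: [model_curve] lifts the segments along the axes to [M],
    so that [g] maps them into [P], and near [q x0] the values of [G] on [P] are squared moduli. *)
Lemma model_facet i : polytope P -> sqmoduli (phi x0) 0 i = 0 ->
  exists2 Fc, facet P Fc & Fc (q x0).
Proof.
move=> hP ai; have Ux0 := lm_base H.
have b0 : ball (q x0) eps (q x0) by apply: ballxx; exact: lm_eps H.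
apply: (boundary_facet hP (orbit_coordP x0) (lm_UG H) (lm_G H) _ (lm_V H)
  (lm_g H) (lm_Vbase H) _ _ _ ai).
- exact: (lm_ballG H).
- by apply/esym/(lm_qg H) => //; exact: lm_Vbase H.
- move=> l; have [j|r r0 Hr] :=
      model_curve _ (nbhsx_ballx _ _ (lm_eps H)) (b := delta_mx 0 l).
    by rewrite mxE; case: (_ && _); rewrite ?ler01.
  exists r => // t tr; have [x [Ux xE <- bx]] := Hr t tr.
  split; first exact: orbit_coordP.
  have [_ -> _] := lm_ball H bx.
  rewrite xE inflate_sqmoduli//; first by case/andP: tr.
  by move=> j; rewrite mxE; case: (_ && _); rewrite ?ler01.
- exists eps; first exact: lm_eps H.
  move=> p /orbit_coord_onto[x <-]; rewrite distrC => bx j.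
  have [|_ -> _] := lm_ball H (x := x); first by rewrite -ball_normE.
  exact: sqmoduli_ge0.
Qed.

Lemma model_stab t x : U x ->
  act t x = x <-> forall l, phi x 0 l != 0 -> Defs.tval (theta t) 0 l = 1.
Proof.
move=> Ux; split => [tx l xl|tx].
  have := lm_act H t Ux; rewrite tx => /rowP/(_ l); rewrite mxE.
  by move=> /esym e; apply: (mulIf xl); rewrite mul1r.
rewrite -[LHS](lm_phiK H); last exact: lm_inv H t x Ux.
rewrite (lm_act H)// -[RHS](lm_phiK H)//; congr psi; apply/rowP => l.
rewrite mxE; have [->|xl] := eqVneq (phi x 0 l) 0; first by rewrite mulr0.
by rewrite tx// mul1r.
Qed.

End Model.
End LocalModel.

(** * Isotropy groups *)

Lemma torus_eqP (R : realType) N (s t : torus R N) :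
  (forall i, Defs.tval s 0 i = Defs.tval t 0 i) -> s = t.
Proof. by move=> st; apply/tval_inj/rowP. Qed.

Lemma torus_automorphism1 (R : realType) N (theta : torus R N -> torus R N) :
  torus_automorphism theta -> theta 1%g = 1%g.
Proof. by move=> [thM _ _]; apply: (mulgI (theta 1%g)); rewrite -thM !mulg1. Qed.

Lemma norm1_expz (R : numFieldType) (z : R) (a : int) : `|z| = 1 -> `|z ^ a| = 1.
Proof.
move=> z1; case: a => m; first by rewrite normrX z1 expr1n.
by rewrite -[z ^ _]/((z ^+ m.+1)^-1) normfV normrX z1 expr1n invr1.
Qed.

(** * Circle subgroups and the subgroups of faces *)

Lemma circle_face (R : realType) n N m (F : 'I_m -> set 'rV[R]_n)
    (lam : 'I_m -> 'rV[int]_N) p j t :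
  F j p -> circle_subgroup (lam j) t -> face_subgroup F lam p t.
Proof.
move=> Fp [z z1 tE]; exists (fun i => if i == j then z else 1); split.
  by move=> i; case: eqP => // _; rewrite normr1.
move=> i; rewrite (bigD1 j)/=; last exact/asboolP.
rewrite eqxx big1 ?mulr1// => l /andP[_ /negbTE->].
by rewrite exp1rz.
Qed.

(** An induction principle: the product defining an element of [face_subgroup] is built one circle
    factor at a time along a list of facets. *)
Lemma face_circle_ind (R : realType) n N m (F : 'I_m -> set 'rV[R]_n)
    (lam : 'I_m -> 'rV[int]_N) p (S : set (torus R N)) :
  S 1%g -> (forall s t, S s -> S t -> S (s * t)%g) ->
  (forall j, F j p -> circle_subgroup (lam j) `<=` S) ->
  face_subgroup F lam p `<=` S.
Proof.
move=> S1 SM SF t [z [z1 tE]].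
suff H (r : seq 'I_m) : exists2 s : torus R N, S s &
    forall i, Defs.tval s 0 i = \prod_(j <- r | `[< F j p >]) z j ^ lam j 0 i.
  have [s Ss sE] := H (index_enum 'I_m).
  by rewrite (_ : t = s)//; apply: torus_eqP => i; rewrite tE sE.
elim: r => [|j r [s Ss sE]].
  by exists 1%g => // i; rewrite big_nil mxE.
have [Fj|nF] := pselect (F j p); last first.
  exists s => // i; rewrite big_cons sE ifF//.
  by apply/negbTE/negP => /asboolP.
have [c cE] : exists c : torus R N, forall i, Defs.tval c 0 i = z j ^ lam j 0 i.
  by apply: torus_row => i; exact: norm1_expz.
exists (c * s)%g.
  by apply: SM => //; apply: (SF j) => //; exists (z j).
by move=> i; rewrite mxE big_cons ifT ?sE ?cE//; apply/asboolP.
Qed.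

Lemma cis_curve_continuous (R : realType) N (l : 'rV[int]_N) (c : R -> torus R N) :
  (forall s i, Defs.tval (c s) 0 i = cis s ^ l 0 i) -> continuous c.
Proof.
move=> cE s; apply: torus_continuous_at => i.
  rewrite (_ : (fun z => _) = cos \o (fun s => s * (l 0 i)%:~R)).
    apply: continuous_comp; last exact: continuous_cos.
    by apply: cvgM; [exact: cvg_id|exact: cvg_cst].
  by apply/funext => u; rewrite /= cE cisMz mulrzr.
rewrite (_ : (fun z => _) = sin \o (fun s => s * (l 0 i)%:~R)).
  apply: continuous_comp; last exact: continuous_sin.
  by apply: cvgM; [exact: cvg_id|exact: cvg_cst].
by apply/funext => u; rewrite /= cE cisMz mulrzr.
Qed.

(** An odd entry makes the parameter [-1] give a nontrivial point of the circle subgroup. *)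
Lemma primitive_odd N (l : 'rV[int]_N) : primitive l ->
  exists i, ~~ (2 %| l ord0 i)%Z.
Proof.
move=> pl; apply: contrapT => /forallNP even.
have /pl : forall i, (2%:Z %| l ord0 i)%Z.
  by move=> i; have /negP := even i; rewrite negbK.
by [].
Qed.

Lemma expN1z_odd (R : unitRingType) (a : int) : ~~ (2 %| a)%Z ->
  (-1 : R) ^ a = -1.
Proof.
move=> a2; have odd_m (m : nat) : odd m -> (-1 : R) ^+ m = -1.
  by move=> om; rewrite -signr_odd om expr1.
rewrite dvdzE/= dvdn2 negbK in a2.
case: a a2 => m /=; first exact: odd_m.
by move=> om; rewrite -[LHS]/(((-1) ^+ m.+1)^-1) odd_m ?invrN1.
Qed.

Section Stabilizer.
Variables (R : realType) (n k m : nat) (M : topologicalType).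
Variables (A : set (chart R M (n.*2 + k))) (act : torus_action R (n + k) M).
Hypothesis hM : locally_kstandard A act.
Variables (P : set 'rV[R]_n) (hP : polytope P).
Variables (F : 'I_m -> set 'rV[R]_n).
Hypothesis hF : range F = [set G | facet P G].
Variable h : orbit_space act -> 'rV[R]_n.
Hypothesis hh :
  diffeomorphism (orbit_atlas A act) (@euclidean_atlas R n) setT P h.
Variable lam : 'I_m -> 'rV[int]_(n + k).
Hypothesis hlam : forall i, primitive (lam i) /\
     [set t | forall x, F i (h (orbit_map act x)) -> act t x = x]
       = circle_subgroup (lam i).
Local Notation q := (orbit_coord h).

Lemma circle_stab j t x : circle_subgroup (lam j) t -> F j (q x) -> act t x = x.
Proof. by have [_ <-] := hlam j; apply. Qed.

(** The circle of [F j] fixes [x], so [theta] maps it into the [i]-th coordinate circle. Its image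
    is a nontrivial one-parameter subgroup, hence all of that circle, and [t] is recovered by
    injectivity of [theta]. *)
Lemma stab_circle (x : M) U theta phi psi W UG G V g eps (i : 'I_n) j t :
  local_model h x U theta phi psi W UG G V g eps ->
  (forall l, l != lshift k i -> phi x 0 l != 0) -> F j (q x) ->
  (forall l, l != lshift k i -> Defs.tval (theta t) 0 l = 1) ->
  circle_subgroup (lam j) t.
Proof.
move=> H xi Fj ti; have Ux := lm_base H.
have [thM thc [th' [thK _ _]]] := lm_theta H.
have [prim _] := hlam j.
have thD s u l : Defs.tval (theta (s * u)%g) 0 l =
    Defs.tval (theta s) 0 l * Defs.tval (theta u) 0 l.
  by rewrite thM mxE.
have [c cE] : exists c : R -> torus R (n + k),
    forall s l, Defs.tval (c s) 0 l = cis s ^ lam j 0 l.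
  have /choice[c cE] : forall s : R, exists u : torus R (n + k),
      forall l, Defs.tval u 0 l = cis s ^ lam j 0 l.
    by move=> s; apply: torus_row => l; apply: norm1_expz; exact: cis_norm.
  by exists c.
have cC s : circle_subgroup (lam j) (c s) by exists (cis s); first exact: cis_norm.
have c1 s l : l != lshift k i -> Defs.tval (theta (c s)) 0 l = 1.
  move=> li; apply: ((model_stab H (c s) Ux).1 _ l (xi l li)).
  exact: circle_stab (cC s) Fj.
have cD s u : c (s + u) = (c s * c u)%g.
  apply: torus_eqP => l; rewrite mxE !cE cisD exprzMl//.
    by rewrite unitfE -normr_eq0 cis_norm oner_eq0.
  by rewrite unitfE -normr_eq0 cis_norm oner_eq0.
pose psi' s := Defs.tval (theta (c s)) 0 (lshift k i).
have psi_onto : forall z, `|z| = 1 -> exists s, psi' s = z.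
  apply: (@circle_hom_onto R psi' pi).
  - by move=> s u; rewrite /psi' cD thD.
  - by move=> s; exact: tvalP.
  - move=> s; apply: (@continuous_comp _ _ _ (theta \o c)
      (fun t : torus R (n + k) => complex.Re (Defs.tval t 0 (lshift k i)))).
      apply: continuous_comp; last exact: thc.
      exact: cis_curve_continuous cE _.
    exact: torus_Re_continuous.
  - have [l /expN1z_odd lodd] := primitive_odd prim.
    apply/eqP => psipi; have : c pi = 1%g.
      apply: (can_inj thK); rewrite (torus_automorphism1 (lm_theta H)).
      apply: torus_eqP => l'; rewrite [RHS]mxE.
      have [->|] := eqVneq l' (lshift k i); first exact: psipi.
      exact: c1.
    move=> /(congr1 (fun u => Defs.tval u 0 l)); rewrite cE [RHS]mxE.
    have -> : cis (pi : R) = -1.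
      by rewrite /cis cospi sinpi; apply/eqP; rewrite eq_complex/= oppr0 !eqxx.
    rewrite lodd => /eqP; rewrite eq_sym -subr_eq0 opprK.
    by rewrite -(natrD _ 1 1) pnatr_eq0.
have [s sE] := psi_onto _ (tvalP (theta t) (lshift k i)).
suff -> : t = c s by [].
apply: (can_inj thK); apply: torus_eqP => l.
have [->|li] := eqVneq l (lshift k i); first by rewrite -sE.
by rewrite ti// c1.
Qed.

(** The facets are closed and finite in number, so those missing [p] also miss a neighborhood of
    [p]. *)
Lemma facets_near p : compact P -> nbhs p [set p' | forall j, F j p' -> F j p].
Proof.
move=> cP; suff /filter_forall : forall j, \forall p' \near p, F j p' -> F j p by [].
move=> j.
have [Fp|nF] := pselect (F j p); first by apply: filterE.
have : [set G | facet P G] (F j) by rewrite -hF; exists j.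
move=> [[c [b [_ FE]]] _].
have Fc : closed (F j).
  rewrite FE; apply: closedI; first by apply: compact_closed => //; exact: norm_hausdorff.
  apply: (@preimage_closed _ _ (fun x : 'rV[R]_n => (x *m c) 0 0) [set b]).
    move=> x _; apply: (@continuous_comp _ _ _ (fun x : 'rV[R]_n => x *m c)
      (fun y : 'rV[R]_1 => y 0 0)); last exact: coord_continuous.
    by apply: (@mulmx_continuous_at _ _ _ _ id) => //; exact: cvg_id.
  exact: closed_eq.
have : nbhs p (~` F j) by apply: open_nbhs_nbhs; split => //; exact: closed_openC.
by apply: filterS.
Qed.

(** The circles of the facets through [q x] fix [x]. Conversely, [theta t] is split into its
    coordinate components; each nontrivial one belongs to a coordinate vanishing at [x], and is
    identified with an element of a facet circle at a nearby point where that coordinate alone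
    vanishes. *)
Lemma stab_face x t : compact P ->
  act t x = x <-> face_subgroup F lam (q x) t.
Proof.
move=> cP; split=> [tx|]; last first.
  apply: (@face_circle_ind R n (n + k) m F lam (q x) [set t | act t x = x]) => /=.
  - exact: tact1.
  - by move=> s u sx ux; rewrite tactM ux sx.
  - by move=> j Fj s cs; exact: circle_stab cs Fj.
have [U [theta [phi [psi [W [UG [G [V [g [eps H]]]]]]]]]] := local_modelP hM hh x.
have Ux := lm_base H.
have [thM thc [th' [thK th'K _]]] := lm_theta H.
have th1 l := (model_stab H t Ux).1 tx l.
have part (i : 'I_n) (s : torus R (n + k)) :
    (forall l, l != lshift k i -> Defs.tval (theta s) 0 l = 1) ->
    (phi x 0 (lshift k i) != 0 -> Defs.tval (theta s) 0 (lshift k i) = 1) ->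
    face_subgroup F lam (q x) s.
  move=> s1 si; have [zi|zi] := eqVneq (phi x 0 (lshift k i)) 0; last first.
    suff -> : s = 1%g by exact: face_subgroup1.
    apply: (can_inj thK); rewrite (torus_automorphism1 (lm_theta H)).
    apply: torus_eqP => l; rewrite [RHS]mxE.
    by have [->|/s1//] := eqVneq l (lshift k i); exact: si.
  (* Inflating along [b] makes every coordinate but the [i]-th nonzero. The facet through the new
     base point already contains [q x], by [facets_near]. *)
  pose b : 'rV[R]_n := \row_l (l != i)%:R.
  have b0 l : 0 <= b 0 l by rewrite mxE ler0n.
  have Bn : nbhs (q x) (ball (q x) eps `&` [set p' | forall j, F j p' -> F j (q x)]).
    by apply: filterI; [exact: nbhsx_ballx (lm_eps H)|exact: facets_near].
  have [r r0 Hr] := model_curve H b0 Bn.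
  have [|y [Uy yE _ [by_ Fy]]] := Hr (r / 2).
    by rewrite divr_ge0 ?ltW//= ltr_pdivrMr// ltr_pMr// ltr1n.
  have [eps' H'] := model_rebase H by_.
  have yz l : l != lshift k i -> phi y 0 l != 0.
    rewrite yE -(splitK l); case: (fintype.split l) => l' /= li; last first.
      by rewrite inflate_r -normr_eq0 (model_kstandard H Ux) oner_eq0.
    rewrite -sqmoduli_eq0 inflate_sqmoduli//; last by rewrite divr_ge0 ?ltW.
    rewrite mxE [X in _ + X]mxE [b _ _]mxE.
    have -> : l' != i by apply: contra li => /eqP->.
    by rewrite mulr1 gt_eqF// ltr_wpDl ?sqmoduli_ge0// divr_gt0.
  have yi : sqmoduli (phi y) 0 i = 0.
    rewrite yE inflate_sqmoduli//; last by rewrite divr_ge0 ?ltW.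
    rewrite mxE [X in _ + X]mxE [b _ _]mxE eqxx mulr0 addr0.
    by apply/eqP; rewrite sqmoduli_eq0 zi.
  have [Fc Ffac Fcy] := model_facet hh H' hP yi.
  have : range F Fc by rewrite hF.
  move=> [j _ jE]; rewrite -jE in Fcy.
  apply: (@circle_face R n (n + k) m F lam (q x) j); first exact: Fy.
  exact: stab_circle H' yz Fcy s1.
(* The components of [theta t] in the coordinates listed in [r], multiplied together and pulled back
   by [theta]; the coordinates in T^k are 1, since those of [phi x] never vanish. *)
have build (r : seq 'I_n) : exists2 u, face_subgroup F lam (q x) u &
    (forall l : 'I_n, Defs.tval (theta u) 0 (lshift k l) =
      if l \in r then Defs.tval (theta t) 0 (lshift k l) else 1) /\
    (forall l : 'I_k, Defs.tval (theta u) 0 (rshift n l) = 1).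
  elim: r => [|i r [u uF [ul ur]]].
    exists 1%g; first exact: face_subgroup1.
    rewrite (torus_automorphism1 (lm_theta H)).
    by split => l; rewrite mxE.
  have [ir|ir] := boolP (i \in r).
    by exists u => //; split => // l; rewrite inE ul; case: eqVneq => // ->; rewrite ir.
  have [w wE] : exists w : torus R (n + k), forall l, Defs.tval w 0 l =
      if l == lshift k i then Defs.tval (theta t) 0 l else 1.
    by apply: torus_row => l; case: (l == _); rewrite ?normr1 ?tvalP.
  exists (th' w * u)%g.
    apply: face_subgroupM => //; apply: (part i).
      by move=> l /negbTE li; rewrite th'K wE li.
    by move=> zi; rewrite th'K wE eqxx; exact: th1.
  split => l; rewrite thM mxE th'K wE.
    rewrite ul inE (inj_eq (@lshift_inj _ _)).
    have [->|li] := eqVneq l i; first by rewrite (negbTE ir) mulr1.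
    by rewrite mul1r.
  by rewrite eq_rlshift mul1r ur.
have [u uF [ul ur]] := build (enum 'I_n).
suff -> : t = u by [].
apply: (can_inj thK); apply: torus_eqP => l; rewrite -(splitK l).
case: (fintype.split l) => l' /=; first by rewrite ul mem_enum.
rewrite ur th1// -normr_eq0 (model_kstandard H Ux) oner_eq0//.
Qed.

End Stabilizer.

(** * Transport in a chart *)

Lemma within_comp (X Y Z : topologicalType) (D : set X) (B : set Y)
    (f : X -> Y) (g : Y -> Z) :
  (forall x, D x -> {for x, continuous f}) -> (forall x, D x -> B (f x)) ->
  {within B, continuous g} -> {within D, continuous (g \o f)}.
Proof.
move=> fD fB /subspace_continuousP gB; apply/subspace_continuousP => x Dx S /= gS.
have /(fD x Dx) := gB _ (fB x Dx) S gS; rewrite !nbhs_simpl/= /within/=.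
by apply: (@filterS _ (nbhs x)) => z /= h Dz; apply: h; exact: fB.
Qed.

Lemma dominated_continuous_at (R : realType) (X : topologicalType) (f g : X -> R)
    (x : X) : (forall z, `|f z| <= g z) -> g x = 0 -> {for x, continuous g} ->
  {for x, continuous f}.
Proof.
move=> fg gx0 gc; have fx0 : f x = 0.
  by apply/eqP; rewrite -normr_le0 -gx0.
apply/cvgrPdist_lt => e e0; rewrite fx0.
have /cvgrPdist_lt/(_ e e0) := gc; rewrite gx0.
apply: filterS => z; rewrite !sub0r !normrN => h.
by apply: le_lt_trans (fg z) _; apply: le_lt_trans (ler_norm _) _.
Qed.

Section Transport.
Variables (R : realType) (n k : nat).

(* A zero coordinate of [z] stays zero, whatever [b] is (division by [0]). *)
Definition reshape_moduli (z : cvec R (n + k)) (b : 'rV[R]_n) : cvec R (n + k) :=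
  \row_i match fintype.split i with
    | inl j => z 0 i * (Num.sqrt (b 0 j) / Num.sqrt (sqmoduli z 0 j))%:C
    | inr _ => z 0 i end.

Lemma reshape_moduli_l z b (j : 'I_n) : reshape_moduli z b 0 (lshift k j) =
  z 0 (lshift k j) * (Num.sqrt (b 0 j) / Num.sqrt (sqmoduli z 0 j))%:C.
Proof. by rewrite mxE (unsplitK (inl _ j)). Qed.

Lemma reshape_moduli_r z b (j : 'I_k) :
  reshape_moduli z b 0 (rshift n j) = z 0 (rshift n j).
Proof. by rewrite mxE (unsplitK (inr _ j)). Qed.

Lemma reshape_moduli_id z : reshape_moduli z (sqmoduli z) = z.
Proof.
apply/rowP => i; rewrite -(splitK i); case: (fintype.split i) => j /=; last first.
  by rewrite reshape_moduli_r.
rewrite reshape_moduli_l; have [/eqP|a0] := eqVneq (sqmoduli z 0 j) 0.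
  by rewrite sqmoduli_eq0 => /eqP->; rewrite mul0r.
by rewrite divff ?mulr1// sqrtr_eq0 -ltNge lt0r a0 sqmoduli_ge0.
Qed.

Lemma reshape_moduli_sqmoduli (z : cvec R (n + k)) (b : 'rV[R]_n) :
  (forall j, 0 <= b 0 j) -> (forall j, sqmoduli z 0 j = 0 -> b 0 j = 0) ->
  sqmoduli (reshape_moduli z b) = b.
Proof.
move=> b0 zb; apply/rowP => j; apply: (@complexI R).
rewrite -sqmoduliE reshape_moduli_l normrM exprMn sqmoduliE.
rewrite ger0_norm ?ler0c ?divr_ge0 ?sqrtr_ge0// -rmorphXn -rmorphM/=.
rewrite exprMn exprVn !sqr_sqrtr ?sqmoduli_ge0//; congr (_%:C).
have [a0|a0] := eqVneq (sqmoduli z 0 j) 0; first by rewrite a0 mul0r zb.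
by rewrite mulrC divfK.
Qed.

(** Where the modulus is nonzero the quotient is continuous. Where it vanishes, so does [b x 0 j],
    and the new coordinate is dominated by [Num.sqrt (b y 0 j)], which tends to 0. *)
Lemma reshape_moduli_continuous_at (X : topologicalType)
    (f : X -> cvec R (n + k)) (b : X -> 'rV[R]_n) (x : X) :
  {for x, continuous f} -> {for x, continuous b} ->
  (forall j, sqmoduli (f x) 0 j = 0 -> b x 0 j = 0) ->
  {for x, continuous (fun y => reshape_moduli (f y) (b y))}.
Proof.
move=> fx bx fb.
have cR i : {for x, continuous (fun y => complex.Re (f y 0 i))}.
  apply: (@continuous_comp _ _ _ f (fun z : cvec R (n + k) => complex.Re (z 0 i))) => //.
  exact: cvec_Re_continuous.
have cI i : {for x, continuous (fun y => complex.Im (f y 0 i))}.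
  apply: (@continuous_comp _ _ _ f (fun z : cvec R (n + k) => complex.Im (z 0 i))) => //.
  exact: cvec_Im_continuous.
have cb j : {for x, continuous (fun y => Num.sqrt (b y 0 j))}.
  apply: (@continuous_comp _ _ _ (fun y => b y 0 j) (fun u : R => Num.sqrt u)).
    apply: (@continuous_comp _ _ _ b (fun u : 'rV[R]_n => u 0 j)) => //.
    exact: coord_continuous.
  exact: sqrt_continuous.
have ca j : {for x, continuous (fun y => Num.sqrt (sqmoduli (f y) 0 j))}.
  apply: (@continuous_comp _ _ _ (fun y => sqmoduli (f y) 0 j)
    (fun u : R => Num.sqrt u)); last exact: sqrt_continuous.
  apply: (@continuous_comp _ _ _ (fun y => sqmoduli (f y))
    (fun u : 'rV[R]_n => u 0 j)); last exact: coord_continuous.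
  by apply: continuous_comp => //; exact: sqmoduli_continuous.
have main j (r : X -> R) : {for x, continuous r} ->
    (forall y, `|r y| <= Num.sqrt (sqmoduli (f y) 0 j)) ->
    {for x, continuous (fun y => r y *
      (Num.sqrt (b y 0 j) / Num.sqrt (sqmoduli (f y) 0 j)))}.
  move=> rc ra; have [a0|a0] := eqVneq (sqmoduli (f x) 0 j) 0.
    apply: (@dominated_continuous_at _ _ _ (fun y => Num.sqrt (b y 0 j))) => //.
      move=> y; rewrite normrM [X in _ * X]ger0_norm; last by rewrite divr_ge0 ?sqrtr_ge0.
      have := ra y; set s := Num.sqrt (sqmoduli _ _ _) => rs.
      have [s0|s0] := eqVneq s 0; first by rewrite s0 invr0 !mulr0 sqrtr_ge0.
      rewrite mulrA ler_pdivrMr; last by rewrite lt0r s0 sqrtr_ge0.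
      by rewrite mulrC ler_wpM2l ?sqrtr_ge0.
    by rewrite fb// sqrtr0.
  apply: cvgM; first exact: rc.
  apply: cvgM; first exact: cb.
  apply: (@cvgV R X (nbhs x) _ (fun y => Num.sqrt (sqmoduli (f y) 0 j))); last exact: ca.
  by rewrite sqrtr_eq0 -ltNge lt0r a0 sqmoduli_ge0.
have le_a (u v : R) : `|u| <= Num.sqrt (u ^+ 2 + v ^+ 2).
  by rewrite -sqrtr_sqr ler_wsqrtr// lerDl sqr_ge0.
apply: cvec_continuous_at => i; rewrite -(splitK i); case: (fintype.split i) => j /=.
- rewrite (_ : (fun y => _) = (fun y => complex.Re (f y 0 (lshift k j)) *
      (Num.sqrt (b y 0 j) / Num.sqrt (sqmoduli (f y) 0 j)))).
    by apply: main => // y; rewrite mxE.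
  by apply/funext => y; rewrite reshape_moduli_l complex_ReM/= mulr0 subr0.
- rewrite (_ : (fun y => _) = (fun y => complex.Re (f y 0 (rshift n j)))) //.
  by apply/funext => y; rewrite reshape_moduli_r.
- rewrite (_ : (fun y => _) = (fun y => complex.Im (f y 0 (lshift k j)) *
      (Num.sqrt (b y 0 j) / Num.sqrt (sqmoduli (f y) 0 j)))).
    by apply: main => // y; rewrite mxE addrC.
  by apply/funext => y; rewrite reshape_moduli_l complex_ImM/= mulr0 add0r.
- rewrite (_ : (fun y => _) = (fun y => complex.Im (f y 0 (rshift n j)))) //.
  by apply/funext => y; rewrite reshape_moduli_r.
Qed.

Variables (m : nat) (M : topologicalType).
Variables (A : set (chart R M (n.*2 + k))) (act : torus_action R (n + k) M).
Variables (P : set 'rV[R]_n) (hP : polytope P).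
Variables (F : 'I_m -> set 'rV[R]_n).
Hypothesis hF : range F = [set G | facet P G].
Variable h : orbit_space act -> 'rV[R]_n.
Hypothesis hh :
  diffeomorphism (orbit_atlas A act) (@euclidean_atlas R n) setT P h.
Local Notation q := (orbit_coord h).

(** Transport gives [phi y] the moduli [G p] and keeps its arguments. If [q y] is on no facet, no
    coordinate in C^n vanishes, by [model_facet]; otherwise [p = q y]. In both cases zero
    coordinates are asked to stay zero, as continuity requires. *)
Lemma model_transport (x0 : M) U theta phi psi W UG G V g eps :
  local_model h x0 U theta phi psi W UG G V g eps ->
  local_transport q P [set p | forall j, ~ F j p] (q x0) eps
    (fun yp => psi (reshape_moduli (phi yp.1) (G yp.2))).
Proof.
move=> H; have [_ _ [th' [_ th'K _]]] := lm_theta H.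
have ball_model y : ball (q x0) eps (q y) -> U y /\ G (q y) = sqmoduli (phi y).
  by move=> /(lm_ball H)[].
have Gp0 p : ball (q x0) eps p -> P p ->
    exists x, [/\ U x, q x = p & G p = sqmoduli (phi x)].
  move=> bp /(orbit_coord_onto hh)[x xp]; exists x.
  by rewrite -xp in bp *; have [] := ball_model x bp.
have face0 y p : transport_domain q P [set p | forall j, ~ F j p] (q x0) eps (y, p) ->
    forall j, sqmoduli (phi y) 0 j = 0 -> G p 0 j = 0.
  move=> [/= b1 b2 _ _ [nF|->]] j aj; last by have [_ ->] := ball_model y b1.
  have [eps' H'] := model_rebase H b1.
  have [Fc Ffac Fcy] := model_facet hh H' hP aj.
  have : range F Fc by rewrite hF.
  by move=> [j' _ jE]; case: (nF j'); rewrite jE.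
(* The reshaped point is in the image of the chart because it has the same moduli as [phi x] for
   some [x] in [U] over [p]: it is a torus translate of [phi x], and [U] is invariant. *)
have tr_image y p :
    transport_domain q P [set p | forall j, ~ F j p] (q x0) eps (y, p) ->
    exists x, [/\ U x, q x = p & phi x = reshape_moduli (phi y) (G p)].
  move=> D; have [/= b1 b2 _ Pp _] := D.
  have [Uy _] := ball_model y b1; have [x [Ux xp GE]] := Gp0 p b2 Pp.
  have [|||t tE] := @same_sqmoduli_orbit R n k (phi x) (reshape_moduli (phi y) (G p)).
  - by move=> j; exact: (model_kstandard H Ux j).
  - by move=> j; rewrite reshape_moduli_r; exact: (model_kstandard H Uy j).
  - rewrite reshape_moduli_sqmoduli ?GE// -?GE; last exact: face0 D.
    by move=> j; rewrite GE sqmoduli_ge0.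
  exists (act (th' t) x); split; first exact: (lm_inv H).
    by rewrite orbit_coord_act.
  by rewrite (lm_act H)// th'K tE.
split.
- apply: (@within_comp _ _ _ _ (phi @` U)
    (fun yp : M * 'rV[R]_n => reshape_moduli (phi yp.1) (G yp.2)) psi).
  + move=> [y p] D; have [/= b1 b2 _ _ _] := D; have [Uy _] := ball_model y b1.
    apply: reshape_moduli_continuous_at.
    * apply: (@continuous_comp _ _ _ fst phi); first exact: cvg_fst.
      exact: (lm_phi H).
    * apply: (@continuous_comp _ _ _ snd G); first exact: cvg_snd.
      by have [] := lm_G H [::] (lm_ballG H b2).
    * exact: face0 D.
  + by move=> [y p] /tr_image[x [Ux _ <-]]; exists x.
  + exact: (lm_psi H).
- by move=> [y p] /tr_image[x [Ux <- /= <-]]; rewrite (lm_phiK H).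
- move=> y _ /ball_model[Uy GE] /=.
  by rewrite GE reshape_moduli_id (lm_phiK H).
Qed.

End Transport.

(** * The homeomorphism *)

Lemma compact_hausdorff_closed_image (X Y : topologicalType) (f : X -> Y)
    (C : set X) :
  compact [set: X] -> hausdorff_space Y -> continuous f -> closed C ->
  closed (f @` C).
Proof.
move=> cX hY fc Cc; apply: compact_closed => //; apply: continuous_compact.
  exact: continuous_subspaceT.
exact: (subclosed_compact Cc cX).
Qed.

Theorem corollary2p4 (R : realType) (n k m : nat)
  (M : topologicalType) (A : set (chart R M (n.*2 + k)))
  (act : torus_action R (n + k) M)
  (hM : locally_kstandard A act)
  (P : set 'rV[R]_n) (hP : simple_polytope P)
  (F : 'I_m -> set 'rV[R]_n)
  (hF : injective F /\ range F = [set G | facet P G])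
  (h : orbit_space act -> 'rV[R]_n)
  (hh : diffeomorphism (orbit_atlas A act) (@euclidean_atlas R n) setT P h)
  (lam : 'I_m -> 'rV[int]_(n + k))
  (hlam : forall i, primitive (lam i) /\
     [set t | forall x, F i (h (orbit_map act x)) -> act t x = x]
       = circle_subgroup (lam i)) :
  exists f : M -> char_space P F lam,
    homeomorphism f /\ forall t x, f (act t x) = char_act t (f x).
Proof.
have [polyP dimP _] := hP; have [_ rF] := hF.
have [[hausM _ _ _ _] [actc _] _ _] := hM.
have [l [v PE]] := polyP; have {}PE : P = hull v by [].
have cP : compact P by rewrite PE; exact: hull_compact.
pose q := orbit_coord h.
have [c Pc cF] : exists2 c, P c & forall G, facet P G -> ~ G c.
  by rewrite PE in dimP *; exact: hull_center.
have Ffacet j : facet P (F j).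
  by have : [set G | facet P G] (F j) by rewrite -rF; exists j.
(* The interior [I] is taken to be the complement of the facets in the ambient space, and [c] the
   center of the contraction. *)
have [s sc qs] : exists2 s : P -> M, continuous s & forall p, q (s p) = set_val p.
  apply: (@global_section _ _ _ _ P [set p | forall j, ~ F j p] c) => //.
  - move=> x t; rewrite PE => Px t01; apply: hull_convex => //.
    by rewrite -PE.
  - move=> x t Px t01 j.
    exact: (facet_segment (Ffacet j) Pc (cF _ (Ffacet j)) Px t01).
  - move=> p /(orbit_coord_onto hh)[x0 <-].
    have [U [theta [phi [psi [W [UG [G [V [g [eps H]]]]]]]]]] :=
      local_modelP hM hh x0.
    exists eps; first exact: lm_eps H.
    by eexists; exact: (model_transport polyP rF hh H).
  - exact: (orbit_coord_onto hh Pc).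
pose Phi (tp : torus R (n + k) * P) := act tp.1 (s tp.2).
have Phic : continuous Phi.
  move=> tp; apply: (@continuous_comp _ _ _
    (fun tp : torus R (n + k) * P => (tp.1, s tp.2))
    (fun p : torus R (n + k) * M => act p.1 p.2)).
    apply: continuous_pair; first exact: cvg_fst.
    by apply: (@continuous_comp _ _ _ snd s); [exact: cvg_snd|exact: sc].
  by apply: (continuous_subspace_setT _).2.
have Phiq tp : q (Phi tp) = set_val tp.2.
  by rewrite -qs; exact: orbit_coord_act.
(* Equal images have equal base points and differ by an element of the isotropy group, which
   [stab_face] identifies with the face subgroup. *)
have PhiP x y : Phi x = Phi y <->
    \pi_(char_space P F lam) x = \pi_(char_space P F lam) y.
  have stab p t : act t (s p) = s p <-> face_subgroup F lam (set_val p) t.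
    by rewrite -qs; exact: (stab_face hM polyP rF hh hlam).
  case: x y => [t p] [u r]; split => [E|/eqmodP/asboolP[/= <-]].
    have pr : p = r by apply: val_inj; have := congr1 q E; rewrite !Phiq.
    subst r; apply/eqmodP/asboolP; split => //=; apply/stab.
    by move: E; rewrite /Phi/= tactM => <-; rewrite -tactM mulVg tact1.
  by move=> /stab; rewrite /Phi/= tactM => E; rewrite -{1}E -tactM mulgV tact1.
have Phi_onto x : exists tp, Phi tp = x.
  have [p pE] : exists p : P, set_val p = q x.
    by exists (SigSub (mem_set (orbit_coordP hh x))).
  have /(orbit_coord_eq hh)[t tx] : q (s p) = q x by rewrite qs.
  by exists (t, p).
(* The choice need not be continuous: by [PhiP] the class of [lift x] depends only on [x]. *)
have [lift liftK] := choice Phi_onto.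
pose f x : char_space P F lam := \pi_(char_space P F lam) (lift x).
pose f' (y : char_space P F lam) := Phi (repr y).
have f'pi tp : f' (\pi_(char_space P F lam) tp) = Phi tp.
  by apply/PhiP; rewrite reprK.
have fK : cancel f f' by move=> x; rewrite /f f'pi liftK.
have f'K : cancel f' f.
  by move=> y; rewrite /f -[RHS]reprK; apply/PhiP; rewrite liftK.
have fPhi tp : f (Phi tp) = \pi_(char_space P F lam) tp.
  by apply/PhiP; rewrite liftK.
exists f; split; last first.
  move=> t x; rewrite -(liftK x) fPhi; case: (lift x) => [u p].
  rewrite [RHS](char_actE F lam t u p) /char_class -fPhi; congr f.
  by rewrite /Phi/= tactM.
split; last first.
  exists f'; split => //.
  apply/quotient_continuous; rewrite (_ : f' \o _ = Phi)//.
  by apply/funext => tp; exact: f'pi.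
(* The preimage under [f] of a closed set is the image under [Phi] of a closed subset of the compact
   space [torus R (n + k) * P]. *)
apply/continuous_closedP => C Cc.
have -> : f @^-1` C = Phi @` (\pi_(char_space P F lam) @^-1` C).
  apply/seteqP; split => [x Cx|_ [tp Ctp <-]]; last by rewrite /= fPhi.
  by exists (lift x).
apply: compact_hausdorff_closed_image => //.
  rewrite -setXTT; apply: compact_setX; first exact: torus_compact.
  exact: set_type_compact.
apply: (preimage_closed _ Cc) => x _; exact: pi_continuous.
Qed.
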